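(* Let $g$ be defined for integers $n \ge 1$, $k \ge 2$ by \[ g(n,k) = \begin{cases} \sqrt{k/n} & \text{if } 2 \le k < 3 n^{1/5}, \\ \left( \dfrac{\log_3 (k/n^{1/5})}{n} \right)^{2/5} & \text{if } 3 n^{1/5} \le k < n^{1/5} 3^n, \\ 1 & \text{if } n^{1/5} 3^n \le k. \end{cases} \] There is a universal constant $C \ge 1$ such that, for all sufficiently large $n$ (that is, all $n \ge n_0$ with $n_0$ not depending on $k$) and all integers $k \ge 2$, \[ \frac{1}{C} \le \frac{\mathcal{R}_n(\mathcal{G}_k)}{g(n,k)} \le C , \] where $\mathcal{R}_n(\mathcal{G}_k)$ is the minimax total variation risk, based on $n$ i.i.d. samples, of the class $\mathcal{G}_k$ of non-increasing convex densities on $\{1,\dots,k\}$.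
   Context: A density on $\mathcal{X} = \{1,\dots,k\}$ is a probability mass function, i.e. a function $p : \{1,\dots,k\} \to [0,\infty)$ with $\sum_{x} p(x) = 1$. $\mathcal{G}_k$ is the class of densities $p$ on $\{1,\dots,k\}$ with $p(x+1) \le p(x)$ for all $x \in \{1,\dots,k-1\}$ and $p(x) - 2p(x+1) + p(x+2) \ge 0$ for all $x \in \{1,\dots,k-2\}$. For functions $q,h : \mathcal{X} \to \mathbb{R}$ put $\mathrm{TV}(q,h) = \frac12 \sum_{x \in \mathcal{X}} |q(x)-h(x)|$. A density estimate is a (possibly randomized) map $\hat f_n : \mathcal{X}^n \to \mathbb{R}^{\mathcal{X}}$. The risk of $\hat f_n$ with respect to a class $\mathcal{F}$ of densities on $\mathcal{X}$ is \[ \mathcal{R}_n(\hat f_n, \mathcal{F}) = \sup_{p \in \mathcal{F}} \mathbb{E}\bigl\{ \mathrm{TV}(\hat f_n(X_1,\dots,X_n), p) \bigr\}, \] where $X_1,\dots,X_n$ are i.i.d. with density $p$ and the expectation is over the samples and any randomization of the estimate. The minimax risk is $\mathcal{R}_n(\mathcal{F}) = \inf_{\hat f_n} \mathcal{R}_n(\hat f_n, \mathcal{F})$, the infimum over all density estimates. *)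

(* Defs.v *)
From HB Require Import structures.
From mathcomp Require Import all_boot all_order all_algebra.
From mathcomp Require Import all_classical all_reals all_analysis.

Set Implicit Arguments.
Unset Strict Implicit.
Unset Printing Implicit Defensive.

Import Order.TTheory GRing.Theory Num.Theory.
Import numFieldNormedType.Exports.

Local Open Scope classical_set_scope.
Local Open Scope ring_scope.

(* Throughout, the point x of {1, ..., k} is the ordinal x - 1 of 'I_k. *)

Definition is_density (R : realType) (k : nat) (p : 'I_k -> R) : Prop :=
  (forall x, 0 <= p x) /\ \sum_(x < k) p x = 1.

Definition noninc_convex_densities (R : realType) (k : nat) :
    set ('I_k -> R) :=
  [set p | [/\ is_density p,
     (forall x y : 'I_k, y = x.+1 :> nat -> p y <= p x) &
     (forall x y z : 'I_k, y = x.+1 :> nat -> z = x.+2 :> nat ->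
        0 <= p x - 2 * p y + p z)]].

Definition TV (R : realType) (k : nat) (q h : 'I_k -> R) : R :=
  2^-1 * \sum_(x < k) `|q x - h x|.

(* A randomized estimate: besides the sample, it reads a seed drawn from an
   arbitrary probability space, independently of the sample.  Its values are
   arbitrary real functions, not necessarily densities. *)
Record estimate (R : realType) (n k : nat) := Estimate {
  seed_display : measure_display ;
  seed : measurableType seed_display ;
  seed_law : probability seed R ;
  estimate_fun : {ffun 'I_n -> 'I_k} -> seed -> 'I_k -> R ;
  measurable_estimate : forall s x,
    measurable_fun [set: seed] (fun w => estimate_fun s w x)
}.
Arguments estimate_fun {R n k} e s w x.

Definition iid_pmf (R : realType) (n k : nat) (p : 'I_k -> R)
    (s : {ffun 'I_n -> 'I_k}) : R :=
  \prod_(i < n) p (s i).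

(* Expectation under the product of the i.i.d. law of the sample (a finite
   sum) and the law of the seed; it may be +oo. *)
Definition expected_TV (R : realType) (n k : nat) (f : estimate R n k)
    (p : 'I_k -> R) : \bar R :=
  (\sum_(s : {ffun 'I_n -> 'I_k})
     (iid_pmf p s)%:E *
       \int[seed_law f]_w (TV (estimate_fun f s w) p)%:E)%E.

Definition risk (R : realType) (n k : nat) (F : set ('I_k -> R))
    (f : estimate R n k) : \bar R :=
  ereal_sup [set expected_TV f p | p in F].

Definition minimax_risk (R : realType) (n k : nat) (F : set ('I_k -> R)) :
    \bar R :=
  ereal_inf [set r | exists f : estimate R n k, r = risk F f].

Definition log3 (R : realType) (x : R) : R := ln x / ln 3.

Definition rate (R : realType) (n k : nat) : R :=
  let m := n%:R `^ 5^-1 in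
  if k%:R < 3 * m then Num.sqrt (k%:R / n%:R)
  else if k%:R < m * 3 ^+ n then (log3 (k%:R / m) / n%:R) `^ (2 / 5)
  else 1.

(* Main.v *)
Require Import Defs.
From HB Require Import structures.
From mathcomp Require Import all_boot all_order all_algebra.
From mathcomp Require Import all_classical all_reals all_analysis.
From mathcomp Require Import measurable_realfun.
From mathcomp Require Import ring lra zify.

Set Implicit Arguments.
Unset Strict Implicit.
Unset Printing Implicit Defensive.

Import Order.TTheory GRing.Theory Num.Theory.
Import numFieldNormedType.Exports.

Local Open Scope classical_set_scope.
Local Open Scope ring_scope.

(** Write [m = n ^ (1/5)], [L = log_3 (k / m)] and [e = (L / n) ^ (1/5)], so that
    the middle rate is [e ^ 2].

    Upper bound.  A kernel average over the window of half-width about [e x]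
    around [x] reproduces linear sequences, so for a convex sequence its bias at
    [x] is governed by the second differences of the density in the window.
    Summed over [x], the bias is at most a constant times
    [e ^ 2 \sum x ^ 2 p''(x)], and summation by parts bounds [\sum x ^ 2 p''(x)]
    by a constant for every non-increasing convex density
    ([curv_moment_le], [total_window_bias]).  The stochastic error is about the
    square root of [S / n], where [S] sums the inverse window widths;
    [S = O(L / e)] because [\sum 1 / (1 + e x)] is a logarithm divided by [e]
    ([sum_window_width_le]).  Both errors are [O(e ^ 2)].  For small [k] the
    empirical distribution achieves [sqrt (k / n)], and for huge [k] the zero
    estimate has bounded risk.

    Lower bound.  A density built as a mixture of hinges [max (t - x) 0] is
    non-increasing and convex whatever its weights.  Four equally spaced hinges
    with weights proportional to [1, -3, 3, -1] add up to a ripple, which is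
    supported between the outer knots and has total mass zero.  Spread [N] dyadic
    scales over the range, with [T] blocks of four knots on each, and let an
    independent sign per block tilt the weights [1, 3, 3, 1] along the ripple.
    The resulting densities differ on disjoint blocks, and with a constant tilt
    two neighbours cannot be told apart from [n] observations as soon as
    [n = O(N T ^ 5)]; Assouad's method ([assouad]) gives a risk of order
    [T ^ -2] ([minimax_risk_ge_multiscale]).  Taking [N] of order [L] and [T] of
    order [(n / N) ^ (1/5)] gives [e ^ 2]; taking [N = n] and [T = 1] gives a
    constant; a single scale with [T] of order [k] and a smaller tilt gives
    [sqrt (k / n)]. *)

(** * The product law of a sample *)

Section iid.
Variables (R : realType) (n k : nat).
Implicit Types p q : 'I_k -> R.

Lemma iid_pmf_ge0 p s : (forall x, 0 <= p x) -> 0 <= iid_pmf (n := n) p s.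
Proof. by move=> p0; apply: prodr_ge0 => i _. Qed.

Lemma iid_expectation_prod p (F : 'I_n -> 'I_k -> R) :
  \sum_(s : {ffun 'I_n -> 'I_k}) iid_pmf p s * \prod_(i < n) F i (s i) =
  \prod_(i < n) \sum_x p x * F i x.
Proof.
rewrite bigA_distr_bigA /=.
by apply: eq_bigr => s _; rewrite /iid_pmf -big_split.
Qed.

Lemma sum_iid_pmf p : is_density p ->
  \sum_(s : {ffun 'I_n -> 'I_k}) iid_pmf p s = 1.
Proof.
move=> [_ p1].
have := iid_expectation_prod p (fun _ _ => 1).
under eq_bigr do rewrite big1 // mulr1.
move=> ->; rewrite big1 // => i _.
by under eq_bigr do rewrite mulr1.
Qed.

Lemma sum_sqrt_iid_pmf p q : (forall x, 0 <= p x) -> (forall x, 0 <= q x) ->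
  \sum_(s : {ffun 'I_n -> 'I_k}) Num.sqrt (iid_pmf p s * iid_pmf q s) =
  (\sum_x Num.sqrt (p x * q x)) ^+ n.
Proof.
move=> p0 q0.
transitivity (\prod_(i < n) \sum_x Num.sqrt (p x * q x)).
  rewrite bigA_distr_bigA /=; apply: eq_bigr => s _.
  rewrite /iid_pmf -big_split /=.
  apply: (@proj2 (0 <= \prod_(i < n) (p (s i) * q (s i)))).
  elim/big_rec2 : _ => [|i y1 y2 _ [y20 <-]]; first by rewrite sqrtr1.
  by split; rewrite ?sqrtrM ?mulr_ge0.
by rewrite prodr_const card_ord.
Qed.

(** Cauchy-Schwarz for [sqrt (P Q) = sqrt (min P Q) * sqrt (max P Q)], where
    [max P Q <= P + Q] sums to at most 2. *)
Lemma sum_min_iid_pmf p q : is_density p -> is_density q ->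
  2^-1 * (\sum_x Num.sqrt (p x * q x)) ^+ (2 * n) <=
  \sum_(s : {ffun 'I_n -> 'I_k}) Num.min (iid_pmf p s) (iid_pmf q s).
Proof.
move=> dp dq; have [p0 _] := dp; have [q0 _] := dq.
set P := fun s : {ffun 'I_n -> 'I_k} => iid_pmf p s.
set Q := fun s : {ffun 'I_n -> 'I_k} => iid_pmf q s.
have P0 s : 0 <= P s by exact: iid_pmf_ge0.
have Q0 s : 0 <= Q s by exact: iid_pmf_ge0.
set r := (\sum_x Num.sqrt (p x * q x)) ^+ n.
have rE : \sum_s Num.sqrt (P s * Q s) = r by exact: sum_sqrt_iid_pmf.
rewrite mulnC exprM -/r.
set m := \sum_s _.
have m0 : 0 <= m by apply: sumr_ge0 => s _; rewrite le_min P0 Q0.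
have : 0 <= r by rewrite -rE; apply: sumr_ge0 => s _; rewrite sqrtr_ge0.
rewrite le_eqVlt => /predU1P[<-|r0]; first by rewrite expr0n mulr0.
(* The arithmetic-geometric mean inequality, with the weight [r / 2] that makes
   it as sharp as Cauchy-Schwarz after summation. *)
have sqrt_le s : Num.sqrt (P s * Q s) * r <=
    r ^+ 2 / 4 * (P s + Q s) + Num.min (P s) (Q s).
  set a := Num.min _ _; set b := Num.max (P s) (Q s).
  have -> : P s * Q s = a * b by rewrite /a /b; case: leP => // _; rewrite mulrC.
  have a0 : 0 <= a by rewrite le_min P0 Q0.
  have b0 : 0 <= b by rewrite le_max P0.
  have bPQ : b <= P s + Q s by rewrite ge_max lerDl lerDr P0 Q0.
  rewrite sqrtrM //.
  apply: le_trans (_ : r ^+ 2 / 4 * b + a <= _); last first.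
    by rewrite lerD2r ler_wpM2l // divr_ge0 ?sqr_ge0.
  rewrite -{2}(sqr_sqrtr a0) -{2}(sqr_sqrtr b0).
  have := sqr_ge0 (r / 2 * Num.sqrt b - Num.sqrt a); nra.
have : r * r <= r ^+ 2 / 4 * 2 + m.
  rewrite -{1}rE mulr_suml; apply: (le_trans (ler_sum _ (fun s _ => sqrt_le s))).
  by rewrite big_split /= -mulr_sumr big_split /= !sum_iid_pmf.
by rewrite expr2; lra.
Qed.
End iid.

(** * Assouad's lower bound *)

(** The quadratic minorant of the geometric mean that turns a bound on the
    squared differences of two densities into a bound on their Hellinger
    affinity. *)
Lemma sqrt_mul_ge (R : realType) (g a b : R) : 0 < g -> g <= a -> g <= b ->
  (a + b) / 2 - (a - b) ^+ 2 / (8 * g) <= Num.sqrt (a * b).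
Proof.
move=> g0 ga gb.
have a0 : 0 <= a by lra.
have b0 : 0 <= b by lra.
have gs : 2 * g <= 2 * Num.sqrt (a * b).
  rewrite ler_pM2l // -(ger0_norm (ltW g0)) -sqrtr_sqr ler_wsqrtr //.
  by rewrite expr2; nra.
rewrite lerBlDr -lerBlDl ler_pdivlMr; last by lra.
have ab : 0 <= a * b by rewrite mulr_ge0.
rewrite sqrtrM // in gs *.
have := sqrtr_ge0 a; have := sqrtr_ge0 b.
have := sqr_sqrtr a0; have := sqr_sqrtr b0.
move: (Num.sqrt a) (Num.sqrt b) gs => u v guv vb ua v0 u0.
rewrite -ua -vb.
have -> : (u ^+ 2 - v ^+ 2) ^+ 2 = (u - v) ^+ 2 * (u + v) ^+ 2 by ring.
have -> : ((u ^+ 2 + v ^+ 2) / 2 - u * v) * (8 * g) = (u - v) ^+ 2 * (4 * g).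
  by field.
rewrite ler_wpM2l ?sqr_ge0 //.
have := sqr_ge0 u; have := sqr_ge0 v; rewrite sqrrD; nra.
Qed.

Lemma hellinger_affinity_ge (R : realType) (k : nat) (g : R)
    (p q : 'I_k -> R) :
  0 < g -> is_density p -> is_density q ->
  (forall x, p x != q x -> g <= p x /\ g <= q x) ->
  1 - (\sum_x (p x - q x) ^+ 2) / (8 * g) <= \sum_x Num.sqrt (p x * q x).
Proof.
move=> g0 [p0 p1] [q0 q1] gpq.
have -> : 1 - (\sum_x (p x - q x) ^+ 2) / (8 * g) =
    \sum_x ((p x + q x) / 2 - (p x - q x) ^+ 2 / (8 * g)).
  by rewrite sumrB -!mulr_suml big_split /= p1 q1 -mulr2n -mulr_natr divff.
apply: ler_sum => x _; have [->|/gpq[gp gq]] := eqVneq (p x) (q x).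
  rewrite subrr expr0n mul0r subr0 -expr2 sqrtr_sqr ger0_norm //; lra.
exact: sqrt_mul_ge.
Qed.

Lemma bernoulli_ge (R : realType) (n : nat) (x : R) : 0 <= x <= 1 ->
  1 - n%:R * (1 - x) <= x ^+ n.
Proof.
move=> /andP[x0 x1]; elim: n => [|n IH]; first by rewrite mul0r subr0.
rewrite exprS -natr1.
have := ler_wpM2l x0 IH.
have : 0 <= n%:R * (1 - x) ^+ 2 by rewrite mulr_ge0 ?sqr_ge0.
lra.
Qed.

Lemma TV_ge0 (R : realType) (k : nat) (q h : 'I_k -> R) : 0 <= TV q h.
Proof. by rewrite mulr_ge0 ?invr_ge0 // sumr_ge0. Qed.

Lemma measurable_TV (R : realType) (n k : nat) (f : estimate R n k) s p :
  measurable_fun [set: seed f] (fun w => TV (estimate_fun f s w) p).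
Proof.
apply: measurable_funM; first exact: measurable_cst.
apply: measurable_sum => x.
apply: measurableT_comp => //.
by apply: measurable_funB; [exact: measurable_estimate|exact: measurable_cst].
Qed.

Section bayes.
Variables (R : realType) (n k : nat) (F : set ('I_k -> R)).

(** The minimax risk exceeds the Bayes risk for the uniform prior on a finite
    subfamily.  Given the sample [s], the bound [A s] holds for every function
    [g], hence also for the random function that a randomized estimate returns,
    whatever its seed. *)
Lemma minimax_risk_ge_bayes (I : finType) (p : I -> 'I_k -> R)
    (A : {ffun 'I_n -> 'I_k} -> R) (c : R) :
  (0 < #|I|)%N -> (forall t, F (p t)) -> (forall t x, 0 <= p t x) ->
  (forall s, 0 <= A s) -> (forall s g, A s <= \sum_t iid_pmf (p t) s * TV g (p t)) ->
  #|I|%:R * c <= \sum_s A s ->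
  (c%:E <= minimax_risk n F)%E.
Proof.
move=> I0 Fp p0 A0 leA cA; apply: le_ereal_inf_tmp => _ [f ->].
have risk_ge t : (expected_TV f (p t) <= risk F f)%E.
  by apply: ereal_sup_ubound; exists (p t).
have integral_ge0 s t :
    (0 <= \int[seed_law f]_w (TV (estimate_fun f s w) (p t))%:E)%E.
  by apply: integral_ge0 => w _; rewrite lee_fin TV_ge0.
have bayes_ge : ((\sum_s A s)%:E <= \sum_t expected_TV f (p t))%E.
  rewrite /expected_TV exchange_big /= -sumEFin; apply: lee_sum => s _.
  under eq_bigr => t _.
    rewrite -ge0_integralZl//; [|exact/measurable_EFinP/measurable_TV| |].
    - over.
    - by move=> w _; rewrite lee_fin TV_ge0.
    - by rewrite lee_fin iid_pmf_ge0.
  rewrite -ge0_integral_sum //; last 2 first.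
  - by move=> t; apply: measurable_funeM; exact/measurable_EFinP/measurable_TV.
  - by move=> t w _; rewrite mule_ge0 // lee_fin ?TV_ge0 ?iid_pmf_ge0.
  have -> : ((A s)%:E = \int[seed_law f]_w (A s)%:E)%E.
    rewrite integral_cst // [X in (_ * X)%E](_ : _ = 1%E) ?mule1 //.
    exact: probability_setT.
  apply: ge0_le_integral => //.
  - by move=> w _; rewrite lee_fin.
  - by apply: emeasurable_sum => t; apply: measurable_funeM;
      exact/measurable_EFinP/measurable_TV.
  - by move=> w _; rewrite sumEFin lee_fin.
have risk0 : (0 <= risk F f)%E.
  have /card_gt0P[t _] := I0; apply: le_trans (risk_ge t).
  by apply: sume_ge0 => s _; rewrite mule_ge0 // lee_fin iid_pmf_ge0.
case E : (risk F f) risk_ge risk0 => [r| |] // risk_ge _; last by rewrite leey.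
rewrite lee_fin -(@ler_pM2l _ #|I|%:R) ?ltr0n //.
apply: le_trans cA _; rewrite -lee_fin; apply: le_trans bayes_ge _.
apply: le_trans (lee_sum _ (fun t _ => risk_ge t)) _.
by rewrite sumEFin sumr_const mulr_natl.
Qed.

Definition flip (J : finType) (j : J) (t : {ffun J -> bool}) :
    {ffun J -> bool} := [ffun i => if i == j then ~~ t i else t i].

Lemma flipK (J : finType) (j : J) : involutive (flip j).
Proof.
by move=> t; apply/ffunP => i; rewrite !ffunE; case: eqP => // _; rewrite negbK.
Qed.

(** Assouad's method.  Since the blocks are disjoint, an estimate must err on
    each of them separately; on block [j] it cannot tell [p t] from
    [p (flip j t)], whose [n]-fold products overlap substantially because their
    Hellinger affinity is [1 - O(1/n)]. *)
Lemma assouad (J : finType) (p : {ffun J -> bool} -> 'I_k -> R)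
    (B : J -> pred 'I_k) (D : R) :
  0 <= D -> (0 < n)%N -> (forall t, F (p t)) -> (forall t, is_density (p t)) ->
  (forall x i j, B i x -> B j x -> i = j) ->
  (forall t j, D <= \sum_(x | B j x) `|p t x - p (flip j t) x|) ->
  (forall t j,
     1 - (4 * n%:R)^-1 <= \sum_x Num.sqrt (p t x * p (flip j t) x)) ->
  ((#|J|%:R * D / 16)%:E <= minimax_risk n F)%E.
Proof.
move=> D0 n0 Fp dp disjB sepB affp.
have p0 t x : 0 <= p t x by have [] := dp t.
pose P t s := iid_pmf (n := n) (p t) s.
have P0 t s : 0 <= P t s by exact: iid_pmf_ge0.
(* Pairing [t] with [flip j t] shows that, given the sample [s], no estimate has
   a smaller Bayes risk than this. *)
pose A s := 4^-1 * \sum_j \sum_t Num.min (P t s) (P (flip j t) s) * D.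
have card0 : (0 < #|{ffun J -> bool}|)%N.
  by apply/card_gt0P; exists [ffun=> true].
apply: (@minimax_risk_ge_bayes {ffun J -> bool} p A) => //.
- move=> s; rewrite mulr_ge0 ?invr_ge0 //; apply: sumr_ge0 => j _.
  by apply: sumr_ge0 => t _; rewrite mulr_ge0 // le_min !P0.
- move=> s g.
  pose err j t := \sum_(x | B j x) `|g x - p t x|.
  have err_sum t : 2^-1 * \sum_j err j t <= TV g (p t).
    rewrite ler_wpM2l ?invr_ge0 // /err.
    under eq_bigr do rewrite big_mkcond /=.
    rewrite exchange_big /=; apply: ler_sum => x _.
    case: (pickP (fun j => B j x)) => [j Bjx|noB]; last first.
      by rewrite big1 // => j _; rewrite noB.
    rewrite (bigD1 j) //= Bjx big1 ?addr0 // => i ij.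
    by case: ifP => // Bix; rewrite (disjB x i j) ?eqxx in ij.
  have err_flip j t : D <= err j t + err j (flip j t).
    apply: le_trans (sepB t j) _; rewrite -big_split /=.
    apply: ler_sum => x _.
    by rewrite -[p t x - _](subrKA (g x)) (le_trans (ler_normD _ _)) // distrC.
  have swap j (G : {ffun J -> bool} -> R) :
      \sum_t G (flip j t) = \sum_t G t.
    by rewrite [RHS](reindex_inj (inv_inj (@flipK J j))).
  apply: le_trans (_ : \sum_t P t s * (2^-1 * \sum_j err j t) <= _); last first.
    by apply: ler_sum => t _; rewrite ler_wpM2l.
  under [leRHS]eq_bigr do rewrite mulrCA mulr_sumr.
  rewrite -mulr_sumr exchange_big /= /A mulr_sumr [leRHS]mulr_sumr.
  apply: ler_sum => j _.
  have -> : \sum_t P t s * err j t = 2^-1 * \sum_t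
      (P t s * err j t + P (flip j t) s * err j (flip j t)).
    rewrite big_split /= (swap j (fun t => P t s * err j t)).
    by field.
  rewrite mulrA; have -> : 2^-1 * 2^-1 = 4^-1 :> R by field.
  rewrite ler_wpM2l ?invr_ge0 //; apply: ler_sum => t _.
  have m0 : 0 <= Num.min (P t s) (P (flip j t) s) by rewrite le_min !P0.
  apply: le_trans (ler_wpM2l m0 (err_flip j t)) _; rewrite mulrDr.
  by apply: lerD; apply: ler_wpM2r;
    rewrite ?sumr_ge0 // ge_min lexx ?orbT.
- have overlap t j : 4^-1 <= \sum_s Num.min (P t s) (P (flip j t) s).
    apply: le_trans (sum_min_iid_pmf _ (dp t) (dp (flip j t))).
    have n1 : 1 <= n%:R :> R by rewrite ler1n.
    have nV0 : (4 * n%:R)^-1 > 0 :> R by rewrite invr_gt0; lra.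
    have nV1 : (4 * n%:R)^-1 <= 4^-1 :> R by rewrite lef_pV2 ?posrE; lra.
    set e := (4 * n%:R)^-1 in nV0 nV1 affp *.
    have /(bernoulli_ge (2 * n)) : 0 <= 1 - e <= 1 by lra.
    have -> : (2 * n)%:R * (1 - (1 - e)) = 2^-1 :> R.
      by rewrite natrM /e; field; lra.
    have : (1 - e) ^+ (2 * n) <=
        (\sum_x Num.sqrt (p t x * p (flip j t) x)) ^+ (2 * n).
      by rewrite lerXn2r ?nnegrE ?affp //; first lra;
        apply: sumr_ge0 => x _; rewrite sqrtr_ge0.
    lra.
  rewrite /A -mulr_sumr exchange_big /=.
  under eq_bigr do rewrite exchange_big /=.
  apply: le_trans (_ : 4^-1 * \sum_(j : J) \sum_(t : {ffun J -> bool})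
                         4^-1 * D <= _); last first.
    rewrite ler_wpM2l ?invr_ge0 //; apply: ler_sum => j _; apply: ler_sum => t _.
    by rewrite -mulr_suml ler_wpM2r.
  rewrite !sumr_const -mulrnA -[_ *+ (_ * _)]mulr_natr natrM.
  by rewrite le_eqVlt; apply/orP; left; apply/eqP; field.
Qed.
End bayes.

(** * Hinges and ripples *)

Section hinge.
Variable R : realType.
Implicit Types (f g : nat -> R) (t h x k : nat) (s : R).

Definition dec_convex f := forall x,
  [/\ 0 <= f x, f x.+1 <= f x & 0 <= f x - 2 * f x.+1 + f x.+2].

Lemma dec_convexD f g : dec_convex f -> dec_convex g ->
  dec_convex (fun x => f x + g x).
Proof. by move=> df dg x; have [? ? ?] := df x; have [? ? ?] := dg x; split; lra. Qed.

Lemma dec_convexZ s f : 0 <= s -> dec_convex f -> dec_convex (fun x => s * f x).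
Proof. by move=> s0 df x; have [? ? ?] := df x; split; nra. Qed.

Lemma dec_convex_sum (I : finType) (F : I -> nat -> R) :
  (forall i, dec_convex (F i)) -> dec_convex (fun x => \sum_i F i x).
Proof.
move=> dF x; split; first by apply: sumr_ge0 => i _; have [] := dF i x.
  by apply: ler_sum => i _; have [] := dF i x.
rewrite mulr_sumr -sumrB -big_split /=.
by apply: sumr_ge0 => i _; have [] := dF i x.
Qed.

Lemma noninc_convex_densitiesP k f : dec_convex f -> \sum_(x < k) f x = 1 ->
  noninc_convex_densities (fun x : 'I_k => f x).
Proof.
move=> df f1; split; first by split => // x; have [] := df x.
  by move=> x y ->; have [] := df x.
by move=> x y z -> ->; have [] := df x.
Qed.

(** The extreme rays of the cone of non-increasing convex sequences that vanish
    eventually; building densities from them makes both shape constraints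
    automatic. *)
Definition hinge t x : R := (t - x)%:R.

Lemma hingeE t x : hinge t x = if (x <= t)%N then t%:R - x%:R else 0.
Proof.
rewrite /hinge; case: leqP => [xt|/ltnW]; first by rewrite natrB.
by rewrite -subn_eq0 => /eqP ->.
Qed.

Lemma dec_convex_hinge t : dec_convex (hinge t).
Proof.
move=> x; rewrite /hinge; split => //; first by rewrite ler_nat leq_sub2l.
have [xt|xt] := leqP x.+2 t.
  by rewrite !natrB ?(ltnW xt) // ?(ltnW (ltnW xt)) // -[x.+2]addn2 -[x.+1]addn1 !natrD; lra.
have -> : (t - x.+1 = 0)%N by lia.
by rewrite mulr0 subr0 addr_ge0.
Qed.

Definition hinge_mass t : R := t%:R * (t%:R + 1) / 2.

Lemma sum_hinge t k : (t <= k)%N -> \sum_(x < k) hinge t x = hinge_mass t.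
Proof.
elim: k t => [|k IH] [|t] tk.
- by rewrite big_ord0 /hinge_mass !mul0r.
- by [].
- by rewrite big1 /hinge_mass ?mul0r // => i _; rewrite /hinge sub0n.
- rewrite big_ord_recl /= /hinge subn0.
  under eq_bigr do rewrite /bump /= add1n subSS.
  rewrite (IH t) // /hinge_mass -natr1. by field.
Qed.

Lemma hinge_mass_gt0 t : (0 < t)%N -> 0 < hinge_mass t.
Proof.
by move=> t0; rewrite /hinge_mass divr_gt0 // mulr_gt0 ?ltr_wpDl ?ltr0n.
Qed.

(** A third difference of hinges.  It annihilates the linear part of the hinges
    to the left of all knots, so the combination is supported between the outer
    knots, and their quadratic total mass, so it sums to zero.  It is piecewise
    linear with values [0, h, -h, 0] at the four knots. *)
Definition ripple t h x : R :=
  hinge t x - 3 * hinge (t + h)%N x + 3 * hinge (t + 2 * h)%N x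
    - hinge (t + 3 * h)%N x.

Lemma ripple_out t h x : (x <= t)%N || (t + 3 * h <= x)%N -> ripple t h x = 0.
Proof.
move=> xth; rewrite /ripple !hingeE !natrD.
case: (leqP x t) xth => [xt _|_ /= xth].
  by rewrite !(leq_trans xt) ?leq_addr //; lra.
have -> : (x <= t + h)%N = (x == t + h :> nat) && (h == 0)%N by lia.
have -> : (x <= t + 2 * h)%N = (x == t + h :> nat) && (h == 0)%N by lia.
have -> : (x <= t + 3 * h)%N = (x == t + 3 * h)%N by lia.
case: eqP => [->|_]; case: eqP => [->|_]; case: eqP => [->|_] /=;
  rewrite ?natrD; lra.
Qed.

Lemma ripple_le t h x : `|ripple t h x| <= h%:R.
Proof.
have h0 : 0 <= h%:R :> R by [].
rewrite ler_norml /ripple !hingeE.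
case: (leqP x (t + 3 * h)); case: (leqP x (t + 2 * h));
  case: (leqP x (t + h)); case: (leqP x t);
  rewrite -?(ltr_nat R) -?(ler_nat R) ?natrD => *; lra.
Qed.

Lemma window_count a m k : (\sum_(x < k) (a <= x < a + m) <= m)%N.
Proof.
suff -> : (\sum_(x < k) (a <= x < a + m) = minn k (a + m) - minn k a)%N by lia.
elim: k => [|k IH]; first by rewrite big_ord0 !min0n.
rewrite big_ord_recr /= IH; case: (boolP (a <= k < a + m)%N) => /=; lia.
Qed.

(** Already the last of the three linear pieces contributes half of [h ^ 2]. *)
Lemma sum_ripple_ge t h k : (t + 3 * h <= k)%N ->
  h%:R ^+ 2 / 2 <= \sum_(x < k | (t <= x < t + 3 * h)%N) `|ripple t h x|.
Proof.
move=> thk.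
have -> : h%:R ^+ 2 / 2 = hinge_mass h - h%:R / 2.
  by rewrite /hinge_mass; field.
apply: le_trans (_ : hinge_mass h <= _); first by rewrite gerBl divr_ge0.
have <- : \sum_(x < k | (t + 2 * h <= x)%N) hinge (t + 3 * h)%N x =
    hinge_mass h.
  rewrite -[LHS](big_geq_mkord _ _ xpredT (hinge (t + 3 * h)%N)).
  rewrite -[X in \sum_(X <= _ < _) _]add0n big_addn big_mkord.
  rewrite -(@sum_hinge h (k - (t + 2 * h))); last lia.
  by apply: eq_bigr => x _; rewrite /hinge; congr _%:R; lia.
rewrite [leLHS]big_mkcond [leRHS]big_mkcond; apply: ler_sum => x _.
case: (leqP (t + 2 * h) x) => [xl|_]; last by case: ifP.
have -> : (t <= x)%N by lia.
rewrite /=; case: ltnP => [xr|xr]; last first.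
  by rewrite /hinge (_ : (t + 3 * h - x = 0)%N) //; lia.
rewrite /ripple /hinge.
have -> : (t - x = 0)%N by lia.
have -> : (t + h - x = 0)%N by lia.
have -> : (t + 2 * h - x = 0)%N by lia.
by rewrite mulr0 subr0 addr0 sub0r normrN ger0_norm.
Qed.

Lemma sum_ripple_sqr_le t h k :
  \sum_(x < k) ripple t h x ^+ 2 <= 3 * h%:R ^+ 3.
Proof.
apply: le_trans (_ : \sum_(x < k) (t <= x < t + 3 * h)%N%:R * h%:R ^+ 2 <= _).
  apply: ler_sum => x _; case: (boolP (t <= x < t + 3 * h)%N) => [_|xout].
    by rewrite mul1r -real_normK ?num_real // lerXn2r ?nnegrE // ripple_le.
  rewrite ripple_out ?expr0n ?mul0r //; lia.
rewrite -mulr_suml -natr_sum [_ ^+ 3]exprS mulrA ler_wpM2r ?sqr_ge0 //.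
by rewrite -natrM ler_nat window_count.
Qed.
End hinge.

(** * Lower bound from perturbations at dyadic scales *)

Section multiscale.
Variables (R : realType) (N T : nat).
Hypotheses (N0 : (0 < N)%N) (T0 : (0 < T)%N).
Implicit Types (a s : R) (k x t h : nat) (j : 'I_N * 'I_T).

(** The index [j = (i, b)] stands for block [b] of scale [i].  Scale [i] is the
    dyadic range from [4 T 2 ^ i] to [8 T 2 ^ i], cut into [T] blocks of four
    consecutive multiples of [2 ^ i], the knots of the hinges. *)
Definition step j : nat := 2 ^ j.1.
Definition block_start j : nat := step j * (4 * T + 4 * j.2).
Definition in_block j x : bool :=
  (block_start j <= x < block_start j + 3 * step j)%N.
(** A hinge at twice the right end of the scale is bounded below on all of it. *)
Definition floor_knot j : nat := step j * (16 * T).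

(** The binomial weights [1, 3, 3, 1] plus [s] times the weights of the ripple:
    they stay nonnegative for [-1 <= s <= 1]. *)
Definition tilted t h s x : R :=
  (1 + s) * hinge R t x + 3 * (1 - s) * hinge R (t + h)%N x
  + 3 * (1 + s) * hinge R (t + 2 * h)%N x + (1 - s) * hinge R (t + 3 * h)%N x.

Definition tilted_mass t h : R :=
  hinge_mass R t + 3 * hinge_mass R (t + h)%N
  + 3 * hinge_mass R (t + 2 * h)%N + hinge_mass R (t + 3 * h)%N.

Lemma tilted_diff t h s x :
  tilted t h s x - tilted t h (- s) x = 2 * s * ripple R t h x.
Proof. rewrite /tilted /ripple; ring. Qed.

Lemma sum_tilted t h s k : (t + 3 * h <= k)%N ->
  \sum_(x < k) tilted t h s x = tilted_mass t h.
Proof.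
move=> thk; rewrite !big_split /= -!mulr_sumr !sum_hinge; try lia.
by rewrite /tilted_mass /hinge_mass !natrD; field.
Qed.

Lemma dec_convex_tilted t h s : -1 <= s <= 1 -> dec_convex (tilted t h s).
Proof.
move=> /andP[s1 s2].
do ![apply: dec_convexD]; apply: dec_convexZ;
  try exact: dec_convex_hinge; lra.
Qed.

(** Each block carries mass [1 / (N T)], half of it on its own knots and half on
    the hinge that keeps the mixture away from zero on the scale. *)
Definition component j s x : R :=
  (2 * N%:R * T%:R)^-1 *
  (tilted (block_start j) (step j) s x / tilted_mass (block_start j) (step j)
   + hinge R (floor_knot j) x / hinge_mass R (floor_knot j)).

Definition mixture a (u : {ffun 'I_N * 'I_T -> bool}) x : R :=
  \sum_j component j (if u j then a else - a) x.

Lemma step_gt0 j : (0 < step j)%N. Proof. by rewrite expn_gt0. Qed.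

Lemma block_start_gt0 j : (0 < block_start j)%N.
Proof. by rewrite muln_gt0 step_gt0 addn_gt0 muln_gt0 T0. Qed.

Lemma floor_knot_gt0 j : (0 < floor_knot j)%N.
Proof. by rewrite muln_gt0 step_gt0 muln_gt0 T0. Qed.

Lemma block_end_le j : (block_start j + 3 * step j <= step j * (8 * T))%N.
Proof.
rewrite /block_start mulnC -mulnDl -mulnDr mulnC leq_mul2l.
by have := ltn_ord j.2; lia.
Qed.

Lemma floor_knot_le j k : (2 ^ N * (8 * T) <= k)%N -> (floor_knot j <= k)%N.
Proof.
apply: leq_trans; rewrite /floor_knot.
have -> : (16 * T = 2 * (8 * T))%N by lia.
rewrite mulnA leq_mul2r -expnSr leq_exp2l // ltn_ord orbT //.
Qed.

Lemma tilted_mass_gt0 j : 0 < tilted_mass (block_start j) (step j).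
Proof.
have j0 := block_start_gt0 j; rewrite /tilted_mass.
have pos d : 0 < hinge_mass R (block_start j + d)%N.
  by rewrite hinge_mass_gt0 // ltn_addr.
have := pos 0%N; have := pos (step j); have := pos (2 * step j)%N.
have := pos (3 * step j)%N; rewrite addn0; lra.
Qed.

Lemma dec_convex_mixture a u : 0 <= a <= 1 -> dec_convex (mixture a u).
Proof.
move=> a01; apply: dec_convex_sum => j; apply: dec_convexZ.
  by rewrite invr_ge0 !mulr_ge0.
apply: dec_convexD.
  under eq_fun do rewrite mulrC.
  apply: dec_convexZ; first by rewrite invr_ge0 ltW // tilted_mass_gt0.
  by apply: dec_convex_tilted; case: ifP; lra.
under eq_fun do rewrite mulrC.
apply: dec_convexZ; last exact: dec_convex_hinge.
by rewrite invr_ge0 ltW // hinge_mass_gt0 // floor_knot_gt0.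
Qed.

Lemma sum_mixture a u k : (2 ^ N * (8 * T) <= k)%N ->
  \sum_(x < k) mixture a u x = 1.
Proof.
move=> NTk; rewrite exchange_big /=.
have NT : 0 < N%:R * T%:R :> R by rewrite mulr_gt0 ?ltr0n.
transitivity (\sum_(j : 'I_N * 'I_T) (N%:R * T%:R)^-1 : R).
  apply: eq_bigr => j _; rewrite -mulr_sumr big_split /= -!mulr_suml.
  have jk := floor_knot_le j NTk.
  rewrite sum_hinge // sum_tilted; last first.
    apply: leq_trans (block_end_le j) (leq_trans _ jk).
    by rewrite leq_mul2l leq_mul2r !orbT.
  rewrite !divff ?gt_eqF ?tilted_mass_gt0 ?hinge_mass_gt0 ?floor_knot_gt0 //.
  by rewrite -mulrA invfM mulrAC mulVf ?mul1r // pnatr_eq0.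
by rewrite sumr_const card_prod !card_ord -[_ *+ _]mulr_natr natrM mulVf // gt_eqF.
Qed.

Lemma in_block_inj j j' x : in_block j x -> in_block j' x -> j = j'.
Proof.
have before i i' : (step i * (4 * T + 4 * i.2) + 4 * step i <=
    step i' * (4 * T + 4 * i'.2))%N -> in_block i x -> in_block i' x -> False.
  by rewrite /in_block /block_start; lia.
have scale_before (i i' : 'I_N * 'I_T) : (i.1 < i'.1)%N ->
    (step i * (4 * T + 4 * i.2) + 4 * step i <= step i' * (4 * T + 4 * i'.2))%N.
  move=> ii'; have : (2 * step i <= step i')%N by rewrite /step -expnS leq_exp2l.
  by have := ltn_ord i.2; nia.
move=> Bj Bj'.
have [ii'|ii'|ii'] := ltngtP j.1 j'.1.
- by case: (before j j') => //; apply: scale_before.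
- by case: (before j' j) => //; apply: scale_before.
have step_eq : step j = step j' by rewrite /step ii'.
have [bb'|bb'|bb'] := ltngtP j.2 j'.2.
- by case: (before j j') => //; rewrite step_eq; nia.
- by case: (before j' j) => //; rewrite step_eq; nia.
by case: j j' ii' bb' {Bj Bj' step_eq} => [i b] [i' b'] /= /val_inj -> /val_inj ->.
Qed.

Lemma mixture_diff a u j x :
  mixture a u x - mixture a (flip j u) x =
  (if u j then 1 else -1) *
  (a / (N%:R * T%:R) / tilted_mass (block_start j) (step j)) *
  ripple R (block_start j) (step j) x.
Proof.
have Z0 := tilted_mass_gt0 j.
have N1 : N%:R != 0 :> R by rewrite pnatr_eq0 -lt0n.
have T1 : T%:R != 0 :> R by rewrite pnatr_eq0 -lt0n.
have diffE s : component j s x - component j (- s) x =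
    s / (N%:R * T%:R) / tilted_mass (block_start j) (step j) *
    ripple R (block_start j) (step j) x.
  rewrite /component -mulrBr opprD addrACA subrr addr0 -mulrBl tilted_diff.
  by field; rewrite N1 T1 gt_eqF.
rewrite /mixture (bigD1 j) //= [X in _ - X](bigD1 j) //= ffunE eqxx.
set S1 := \sum_(i | _) _; set S2 := \sum_(i | _) _.
have -> : S1 = S2.
  by apply: eq_bigr => i ij; rewrite ffunE (negPf ij).
rewrite opprD addrACA subrr addr0.
case: (u j) => /=; first by rewrite diffE mul1r.
by rewrite -{2}[a]opprK diffE !mulNr mul1r.
Qed.

Lemma step_natr j : 0 < (step j)%:R :> R.
Proof. by rewrite ltr0n step_gt0. Qed.

Lemma tilted_mass_ge j :
  64 * T%:R ^+ 2 * (step j)%:R ^+ 2 <= tilted_mass (block_start j) (step j).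
Proof.
have ge d : (step j)%:R ^+ 2 * T%:R ^+ 2 * 8 <= hinge_mass R (block_start j + d)%N.
  rewrite /hinge_mass.
  have : 4 * (step j)%:R * T%:R <= (block_start j + d)%:R :> R.
    rewrite -!natrM ler_nat /block_start; nia.
  have : 0 <= (step j)%:R * T%:R :> R by rewrite mulr_ge0.
  nra.
have := ge 0%N; have := ge (step j); have := ge (2 * step j)%N.
have := ge (3 * step j)%N; rewrite /tilted_mass addn0; lra.
Qed.

Lemma tilted_mass_le j :
  tilted_mass (block_start j) (step j) <= 512 * T%:R ^+ 2 * (step j)%:R ^+ 2.
Proof.
have le d : (d <= 3 * step j)%N ->
    hinge_mass R (block_start j + d)%N <= (step j)%:R ^+ 2 * T%:R ^+ 2 * 64.
  move=> dj; have b0 := block_start_gt0 j.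
  have : 1 <= (block_start j + d)%:R :> R by rewrite ler1n ltn_addr.
  have : (block_start j + d)%:R <= 8 * (step j)%:R * T%:R :> R.
    rewrite -!natrM ler_nat; have := block_end_le j; lia.
  rewrite /hinge_mass; nra.
have := le 0%N; have := le (step j); have := le (2 * step j)%N.
have := le (3 * step j)%N; rewrite /tilted_mass addn0.
move=> /(_ (leqnn _)) h1 /(_ ltac:(lia)) h2 /(_ ltac:(lia)) h3 /(_ ltac:(lia)) h4.
lra.
Qed.

(** The hinges at [floor_knot] alone make the mixture at least of the order of
    [1 / (N x)] on every block. *)
Lemma mixture_ge a u j x : 0 <= a <= 1 -> in_block j x ->
  (64 * N%:R * T%:R * (step j)%:R)^-1 <= mixture a u x.
Proof.
move=> a01 /andP[_ xj].
have N1 : 0 < N%:R :> R by rewrite ltr0n.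
have T1 : 0 < T%:R :> R by rewrite ltr0n.
have h1 := step_natr j.
have tilted0 (j' : 'I_N * 'I_T) s : -1 <= s <= 1 ->
    0 <= tilted (block_start j') (step j') s x / tilted_mass (block_start j') (step j').
  move=> s1; rewrite divr_ge0 ?(ltW (tilted_mass_gt0 _)) //.
  by have [] := dec_convex_tilted (block_start j') (step j') s1 x.
have floor0 (j' : 'I_N * 'I_T) :
    0 <= hinge R (floor_knot j') x / hinge_mass R (floor_knot j').
  by rewrite divr_ge0 ?(ltW (hinge_mass_gt0 _ (floor_knot_gt0 _))).
have s1 b : -1 <= (if b then a else - a) <= 1 by case: b; lra.
have NT0 : 0 <= (2 * N%:R * T%:R)^-1 :> R by rewrite invr_ge0 !mulr_ge0 ?ltW.
have -> : mixture a u x =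
    \sum_i \sum_b component (i, b) (if u (i, b) then a else - a) x.
  by rewrite pair_bigA; apply: eq_bigr => -[].
rewrite (bigD1 j.1) //=.
rewrite -[leLHS]addr0 lerD //; last first.
  apply: sumr_ge0 => i _; apply: sumr_ge0 => b _.
  by rewrite mulr_ge0 // addr_ge0 // tilted0.
have -> : (64 * N%:R * T%:R * (step j)%:R)^-1 =
    \sum_(b < T) (2 * N%:R * T%:R)^-1 * (32 * T%:R * (step j)%:R)^-1 :> R.
  rewrite sumr_const card_ord -[_ *+ _]mulr_natr; field.
  by rewrite !gt_eqF.
apply: ler_sum => b _; rewrite ler_wpM2l //.
rewrite -[leLHS]add0r lerD ?tilted0 //.
have xt : (x <= floor_knot (j.1, b))%N.
  apply: leq_trans (ltnW xj) (leq_trans (block_end_le j) _).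
  by rewrite /floor_knot /step /= leq_mul2l leq_mul2r !orbT.
have x8 : x%:R <= 8 * T%:R * (step j)%:R :> R.
  by rewrite -!natrM ler_nat; have := block_end_le j; lia.
rewrite /hinge natrB // /hinge_mass /floor_knot -/(step j).
have -> : step (j.1, b) = step j by [].
rewrite natrM natrM.
have hT : 1 <= (step j)%:R * T%:R :> R by rewrite -natrM ler1n muln_gt0 step_gt0.
rewrite ler_pdivlMr; last by nra.
rewrite ler_pdivrMl; last by rewrite !mulr_gt0.
nra.
Qed.

End multiscale.

(** On a block the mixture is at least of order [1 / (N T h)], with [h] the step,
    and the ripple enters with a coefficient of order [a / (N T ^ 3 h ^ 2)].
    Hence two densities that differ on one block are at total variation distance
    of order [a / (N T ^ 3)] and squared Hellinger distance of order
    [a ^ 2 / (N T ^ 5)], whatever the scale, and there are [N T] blocks. *)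
Lemma minimax_risk_ge_multiscale (R : realType) (n k N T : nat) (a : R) :
  (0 < n)%N -> (0 < N)%N -> (0 < T)%N -> (2 ^ N * (8 * T) <= k)%N ->
  0 <= a <= 1 -> a ^+ 2 * n%:R <= N%:R * T%:R ^+ 5 ->
  ((a / T%:R ^+ 2 / 1024 / 16)%:E <=
     minimax_risk n (@noninc_convex_densities R k))%E.
Proof.
move=> n0 N0 T0 NTk a01 aNT; have /andP[a0 a1] := a01.
have N1 : 0 < N%:R :> R by rewrite ltr0n.
have T1 : 0 < T%:R :> R by rewrite ltr0n.
have n1 : 0 < n%:R :> R by rewrite ltr0n.
have Fp (u : {ffun 'I_N * 'I_T -> bool}) : noninc_convex_densities (fun x : 'I_k => mixture a u x).
  apply: (noninc_convex_densitiesP (f := mixture a u)).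
    exact: dec_convex_mixture.
  exact: sum_mixture.
have -> : a / T%:R ^+ 2 / 1024 / 16 =
   #|{: 'I_N * 'I_T}|%:R * (a / (1024 * N%:R * T%:R ^+ 3)) / 16.
  rewrite card_prod !card_ord natrM; field; by rewrite !gt_eqF.
have weight u j : 0 <= a / (N%:R * T%:R) / tilted_mass R (block_start j) (step j) /\
    `|(if (u : {ffun 'I_N * 'I_T -> bool}) j then 1 else -1) *
       (a / (N%:R * T%:R) / tilted_mass R (block_start j) (step j))| =
    a / (N%:R * T%:R) / tilted_mass R (block_start j) (step j).
  have c0 : 0 <= a / (N%:R * T%:R) / tilted_mass R (block_start j) (step j).
    by apply: divr_ge0; [rewrite divr_ge0 ?mulr_ge0|exact/ltW/tilted_mass_gt0].
  by split=> //; rewrite normrM (ger0_norm c0); case: ifP; rewrite ?normrN normr1 mul1r.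
apply: (@assouad _ _ _ _ _ (fun u x => mixture a u x)
  (fun j x => in_block j x) (a / (1024 * N%:R * T%:R ^+ 3))).
- apply: divr_ge0; first exact: a0.
  have : 0 < N%:R * T%:R ^+ 3 :> R by rewrite mulr_gt0 ?exprn_gt0.
  by rewrite -mulrA; lra.
- exact: n0.
- exact: Fp.
- by move=> u; have [] := Fp u.
- by move=> x i j; exact: in_block_inj.
- move=> u j; have [c0 cE] := weight u j.
  under eq_bigr do rewrite mixture_diff // normrM cE.
  rewrite -mulr_sumr.
  have jk : (block_start j + 3 * step j <= k)%N.
    apply: leq_trans (block_end_le N0 T0 j) _; apply: leq_trans NTk.
    by rewrite leq_mul2r /step leq_exp2l // (ltnW (ltn_ord _)) orbT.
  apply: le_trans (ler_wpM2l c0 (sum_ripple_ge R jk)).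
  have h1 : 0 < (step j)%:R :> R by rewrite step_natr.
  have Z0 := tilted_mass_gt0 R T0 j.
  have -> : a / (1024 * N%:R * T%:R ^+ 3) = a / (N%:R * T%:R)
      / (512 * T%:R ^+ 2 * (step j)%:R ^+ 2) * ((step j)%:R ^+ 2 / 2).
    by field; rewrite !gt_eqF.
  apply: ler_wpM2r; first by rewrite divr_ge0 ?sqr_ge0.
  apply: ler_wpM2l; first by apply: divr_ge0 => //; rewrite mulr_ge0.
  by rewrite lef_pV2 ?tilted_mass_le // posrE // (lt_le_trans Z0) // tilted_mass_le.
- move=> u j.
  have h1 : 0 < (step j)%:R :> R by rewrite step_natr.
  have Z0 := tilted_mass_gt0 R T0 j.
  have g0 : 0 < (64 * N%:R * T%:R * (step j)%:R)^-1 :> R.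
    by rewrite invr_gt0 !mulr_gt0.
  apply: le_trans (hellinger_affinity_ge g0 _ _ _); last first.
  - move=> x pq; have [inj|outj] := boolP (in_block j x).
      by rewrite !mixture_ge.
    case/eqP: pq; apply/eqP; rewrite -subr_eq0 mixture_diff // ripple_out ?mulr0 //.
    by move: outj; rewrite /in_block; lia.
  - by have [] := Fp (flip j u).
  - by have [] := Fp u.
  rewrite lerD2l lerN2.
  have [c0 cE] := weight u j.
  under eq_bigr do rewrite mixture_diff // exprMn -real_normK ?num_real // cE.
  rewrite -mulr_sumr; set c := a / _ / _ in c0 *.
  set h : R := (step j)%:R in h1 g0 *.
  have cle : c <= a / (64 * N%:R * T%:R ^+ 3 * h ^+ 2).
    have -> : a / (64 * N%:R * T%:R ^+ 3 * h ^+ 2) =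
        a / (N%:R * T%:R) / (64 * T%:R ^+ 2 * h ^+ 2).
      by field; rewrite !gt_eqF.
    rewrite /c ler_wpM2l //; first by apply: divr_ge0 => //; rewrite mulr_ge0.
    rewrite lef_pV2 ?tilted_mass_ge // posrE //.
    by rewrite !mulr_gt0 ?exprn_gt0.
  have NT5 : 0 < N%:R * T%:R ^+ 5 :> R by rewrite mulr_gt0 ?exprn_gt0.
  apply: le_trans (_ : (a / (64 * N%:R * T%:R ^+ 3 * h ^+ 2)) ^+ 2 * (3 * h ^+ 3)
     / (8 * (64 * N%:R * T%:R * h)^-1) <= _).
    apply: ler_wpM2r; first by rewrite invr_ge0 mulr_ge0 // ltW.
    apply: ler_pM; rewrite ?sqr_ge0 ?sumr_ge0 //.
    - by move=> x _; rewrite sqr_ge0.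
    - by rewrite lerXn2r ?nnegrE // (le_trans c0).
    - exact: sum_ripple_sqr_le.
  have -> : (a / (64 * N%:R * T%:R ^+ 3 * h ^+ 2)) ^+ 2 * (3 * h ^+ 3)
     / (8 * (64 * N%:R * T%:R * h)^-1) = 3 / 512 * (a ^+ 2 / (N%:R * T%:R ^+ 5)).
    by field; rewrite !gt_eqF.
  apply: le_trans (_ : 3 / 512 * n%:R^-1 <= _).
    apply: ler_wpM2l; first lra.
    by rewrite ler_pdivrMr // ler_pdivlMl // mulrC.
  rewrite invfM; apply: ler_wpM2r; first by rewrite invr_ge0 ltW.
  lra.
Qed.

(** * Lower bound from two densities *)

(** The convexity of [(3/4, 1/4, 0, ...)] is strict enough at the first two
    points to survive moving a mass of order [n ^ (-1/2)] between them. *)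
Lemma minimax_risk_ge_two_points (R : realType) (n k : nat) :
  (0 < n)%N -> (1 < k)%N ->
  (((48 * Num.sqrt n%:R)^-1)%:E <=
     minimax_risk n (@noninc_convex_densities R k))%E.
Proof.
move=> n0 k2.
have n1 : 1 <= n%:R :> R by rewrite ler1n.
have r1 : 1 <= Num.sqrt n%:R :> R by rewrite -[leLHS]sqrtr1 ler_wsqrtr.
have rr : Num.sqrt n%:R ^+ 2 = n%:R :> R by rewrite sqr_sqrtr // ltW // lt_le_trans n1.
set r : R := Num.sqrt _ in r1 rr *.
pose d : R := (12 * r)^-1.
have d0 : 0 < d by rewrite invr_gt0; lra.
have d12 : d <= 1 / 12 by rewrite div1r lef_pV2 ?posrE; lra.
pose s (u : {ffun unit -> bool}) := if u tt then d else - d.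
(* The density [(3/4 + s u, 1/4 - s u, 0, ...)] as a combination of hinges. *)
pose f u x := (1 / 4 + 3 * s u) * hinge R 1 x + (1 / 4 - s u) * hinge R 2 x.
have s_le u : - d <= s u <= d by rewrite /s; case: (u tt); lra.
have Fp u : noninc_convex_densities (fun x : 'I_k => f u x).
  have := s_le u => su; apply: (noninc_convex_densitiesP (f := f u)).
    by apply: dec_convexD; apply: dec_convexZ; try exact: dec_convex_hinge; lra.
  rewrite big_split /= -!mulr_sumr !sum_hinge // ?(ltnW k2) // /hinge_mass.
  by field.
pose e x := hinge R 2 x - hinge R 1 x.
have e_sum : \sum_(x < k) e x = 2.
  by rewrite sumrB !sum_hinge // ?(ltnW k2) // /hinge_mass; field.
have diffE u x : [/\ `|f u x - f (flip tt u) x| = 2 * d * e x &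
    (f u x - f (flip tt u) x) ^+ 2 = 4 * d ^+ 2 * e x].
  have -> : f u x - f (flip tt u) x = 2 * s u * (3 * hinge R 1 x - hinge R 2 x).
    by rewrite /f /s ffunE eqxx; case: (u tt) => /=; ring.
  have -> : 4 * d ^+ 2 = 4 * s u ^+ 2 by rewrite /s; case: (u tt); rewrite ?sqrrN.
  have -> : 2 * d = `|2 * s u|.
    by rewrite normrM ger0_norm // /s; case: (u tt); rewrite ?normrN ger0_norm // ltW.
  rewrite normrM exprMn /e /hinge; case: x => [|[|x]] /=.
  - have -> : 3 * (1 - 0)%:R - (2 - 0)%:R = 1 :> R by rewrite !subn0; lra.
    have -> : (2 - 0)%:R - (1 - 0)%:R = 1 :> R by rewrite !subn0; lra.
    by rewrite normr1 expr1n; split=> //; ring.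
  - have -> : 3 * (1 - 1)%:R - (2 - 1)%:R = -1 :> R by rewrite (_ : (2 - 1 = 1)%N) // subnn; lra.
    have -> : (2 - 1)%:R - (1 - 1)%:R = 1 :> R by rewrite (_ : (2 - 1 = 1)%N) // subnn; lra.
    by rewrite normrN1 sqrrN expr1n; split=> //; ring.
  - rewrite !subSS !sub0n mulr0 subrr normr0 expr0n !mulr0; split=> //.
have -> : (48 * r)^-1 = #|{: unit}|%:R * (4 * d) / 16.
  by rewrite card_unit /d; field; lra.
apply: (@assouad _ _ _ _ _ (fun u x => f u x) (fun _ _ => true)).
- by rewrite mulr_ge0 // ltW.
- exact: n0.
- exact: Fp.
- by move=> u; have [] := Fp u.
- by move=> x [] [].
- move=> u []; under eq_bigr do rewrite (diffE _ _).1.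
  rewrite -mulr_sumr e_sum; lra.
- move=> u [].
  have g0 : 0 < 8^-1 :> R by lra.
  apply: le_trans (hellinger_affinity_ge g0 _ _ _); last first.
  - move=> x pq; have f_ge v : 8^-1 <= f v x.
      have := s_le v; move: pq; rewrite /f /hinge.
      case: (x : nat) => [|[|y]]; rewrite ?subSS ?sub0n ?subn0 ?mulr0 ?addr0 ?eqxx //.
        by move=> _ /andP[? ?]; lra.
      by move=> _ /andP[? ?]; lra.
    by split.
  - by have [] := Fp (flip tt u).
  - by have [] := Fp u.
  rewrite lerD2l lerN2.
  under eq_bigr do rewrite (diffE _ _).2.
  rewrite -mulr_sumr e_sum /d.
  have -> : 4 * (12 * r)^-1 ^+ 2 * 2 / (8 / 8) = (18 * r ^+ 2)^-1 by field; lra.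
  by rewrite rr lef_pV2 ?posrE; lra.
Qed.

(** * Linear estimates *)

Section linear_estimates.
Variables (R : realType) (n k : nat).
Implicit Types (p phi : 'I_k -> R).

Lemma iid_variance_le p phi : (0 < n)%N -> is_density p ->
  \sum_(s : {ffun 'I_n -> 'I_k}) iid_pmf p s *
     (n%:R^-1 * (\sum_i phi (s i)) - \sum_y p y * phi y) ^+ 2 <=
  n%:R^-1 * \sum_y p y * phi y ^+ 2.
Proof.
move=> n0 dp; have [p0 p1] := dp; set mu := \sum_y p y * phi y.
have n1 : n%:R != 0 :> R by rewrite pnatr_eq0 -lt0n.
pose xi y := phi y - mu.
have xi_mean : \sum_y p y * xi y = 0.
  under eq_bigr do rewrite mulrBr.
  by rewrite sumrB -mulr_suml p1 mul1r subrr.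
have xi_var : \sum_y p y * xi y ^+ 2 <= \sum_y p y * phi y ^+ 2.
  have -> : \sum_y p y * xi y ^+ 2 = \sum_y p y * phi y ^+ 2 - mu ^+ 2.
    rewrite (eq_bigr (fun y => p y * phi y ^+ 2 - p y * phi y * (2 * mu)
      + p y * mu ^+ 2)); last by move=> y _; rewrite /xi; ring.
    by rewrite big_split sumrB /= -!mulr_suml p1 -/mu; ring.
  by rewrite gerBl sqr_ge0.
have cross i j : \sum_(s : {ffun 'I_n -> 'I_k}) iid_pmf p s * (xi (s i) * xi (s j)) =
    if i == j then \sum_y p y * xi y ^+ 2 else 0.
  pose F l y := (if l == i then xi y else 1) * (if l == j then xi y else 1).
  transitivity (\prod_(l < n) \sum_y p y * F l y).
    rewrite -iid_expectation_prod; apply: eq_bigr => s _; congr (_ * _).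
    by rewrite big_split /= -!big_mkcond /= !big_pred1_eq.
  rewrite (bigD1 i) //= {1}/F eqxx; have [ij|ij] := eqVneq i j.
    rewrite [X in _ * X]big1 ?mulr1; first by under eq_bigr do rewrite -expr2.
    move=> l li; rewrite -[RHS]p1; apply: eq_bigr => y _.
    by rewrite /F -ij (negPf li) !mulr1.
  by under eq_bigr do rewrite mulr1; rewrite xi_mean mul0r.
have -> : \sum_(s : {ffun 'I_n -> 'I_k}) iid_pmf p s *
     (n%:R^-1 * (\sum_i phi (s i)) - mu) ^+ 2 =
   n%:R^-1 ^+ 2 * \sum_(i < n) \sum_(j < n) \sum_(s : {ffun 'I_n -> 'I_k})
     iid_pmf p s * (xi (s i) * xi (s j)).
  under [in RHS]eq_bigr do rewrite exchange_big /=.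
  rewrite exchange_big mulr_sumr; apply: eq_bigr => s _ /=.
  have -> : n%:R^-1 * (\sum_i phi (s i)) - mu = n%:R^-1 * \sum_i xi (s i).
    by rewrite sumrB sumr_const card_ord -[mu *+ n]mulr_natl; field.
  rewrite exprMn mulrCA; congr (_ * _); rewrite expr2 mulr_suml mulr_sumr.
  by apply: eq_bigr => i _; rewrite -!mulr_sumr.
under eq_bigr => i _.
  under eq_bigr do rewrite cross eq_sym.
  rewrite -big_mkcond /= big_pred1_eq. over.
rewrite sumr_const card_ord -[X in _ * X <= _]mulr_natl.
set V := \sum_y _; have -> : n%:R^-1 ^+ 2 * (n%:R * V) = n%:R^-1 * V by field.
by rewrite ler_wpM2l ?invr_ge0.
Qed.

Lemma le_norm_amgm (t x : R) : 0 < t -> `|x| <= (t + x ^+ 2 / t) / 2.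
Proof.
move=> t0; rewrite ler_pdivlMr // -[x ^+ 2]real_normK ?num_real //.
rewrite -lerBlDl ler_pdivlMr //; have := sqr_ge0 (`|x| - t); nra.
Qed.

Definition linear_estimate (K : 'I_k -> 'I_k -> R)
    (s : {ffun 'I_n -> 'I_k}) (x : 'I_k) : R := n%:R^-1 * \sum_i K x (s i).

(** Bias-variance decomposition.  The free scale [tau x] stands for the standard
    deviation of the estimate at [x]. *)
Lemma linear_estimate_TV_le (K : 'I_k -> 'I_k -> R) (tau : 'I_k -> R) p :
  (0 < n)%N -> is_density p -> (forall x, 0 < tau x) ->
  \sum_s iid_pmf p s * TV (linear_estimate K s) p <=
  2^-1 * \sum_x (`|\sum_y p y * K x y - p x| +
    (tau x + n%:R^-1 * (\sum_y p y * K x y ^+ 2) / tau x) / 2).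
Proof.
move=> n0 dp tau0; have [p0 p1] := dp.
under eq_bigr do rewrite mulrCA mulr_sumr.
rewrite -mulr_sumr ler_wpM2l ?invr_ge0 // exchange_big /=.
apply: ler_sum => x _; set a := \sum_y p y * K x y.
apply: le_trans (_ : \sum_(s : {ffun 'I_n -> 'I_k}) iid_pmf p s *
  (`|a - p x| + (tau x + (linear_estimate K s x - a) ^+ 2 / tau x) / 2) <= _).
  apply: ler_sum => s _; rewrite ler_wpM2l ?iid_pmf_ge0 //.
  have -> : linear_estimate K s x - p x =
    (a - p x) + (linear_estimate K s x - a) by ring.
  apply: le_trans (ler_normD _ _) _; rewrite lerD2l.
  exact: le_norm_amgm.
rewrite (eq_bigr (fun s => iid_pmf p s * (`|a - p x| + tau x / 2) +
    iid_pmf p s * (linear_estimate K s x - a) ^+ 2 * ((tau x)^-1 / 2)));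
  last by move=> s _; field; rewrite gt_eqF.
rewrite big_split /= -!mulr_suml sum_iid_pmf // mul1r [in leRHS]mulrDl addrA.
rewrite lerD2l -[leRHS]mulrA ler_wpM2r ?iid_variance_le //.
by rewrite divr_ge0 // invr_ge0 ltW.
Qed.
End linear_estimates.

Section deterministic.
Variables (R : realType) (n k : nat) (g : {ffun 'I_n -> 'I_k} -> 'I_k -> R).

Definition deterministic_estimate : estimate R n k :=
  @Estimate R n k _ unit (dirac tt) (fun s _ => g s)
    (fun s x => @measurable_cst _ _ unit R setT (g s x)).

Lemma minimax_risk_le_deterministic (F : set ('I_k -> R)) (c : R) :
  (forall p, F p -> \sum_s iid_pmf p s * TV (g s) p <= c) ->
  (minimax_risk n F <= c%:E)%E.
Proof.
move=> le_c; apply: ge_ereal_inf; exists (risk F deterministic_estimate).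
  by exists deterministic_estimate.
apply: ge_ereal_sup => _ [p Fp <-].
have const_integral s : (\int[seed_law deterministic_estimate]_w
    (TV (estimate_fun deterministic_estimate s w) p)%:E = (TV (g s) p)%:E)%E.
  rewrite /= integral_cst // [X in (_ * X)%E](_ : _ = 1%E) ?mule1 //.
  exact: probability_setT.
rewrite /expected_TV; under eq_bigr do rewrite const_integral -EFinM.
by rewrite sumEFin lee_fin le_c.
Qed.
End deterministic.

(** * Bias of symmetric windows *)

Section convex_sequence.
Variables (R : realType) (k : nat) (f : nat -> R).
Hypothesis f_convex : forall x, (x.+2 < k)%N -> 0 <= f x - 2 * f x.+1 + f x.+2.
Implicit Types x y z h q : nat.

Definition curv z : R := f z - 2 * f z.+1 + f z.+2.

Definition in_window x h y := (x <= y + h)%N && (y <= x + h)%N.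

Definition window_sum x h : R := \sum_(y < k) (in_window x h y)%:R * f y.

(** [curv z] involves the points [z], [z + 1] and [z + 2]; the curvature counts
    when all three lie in the window. *)
Definition window_curv x h : R :=
  \sum_(z < k - 2) ((x <= z + h)%N && (z.+1 < x + h)%N)%:R * curv z.

Lemma curv_ge0 z : (z < k - 2)%N -> 0 <= curv z.
Proof. by move=> zk; apply: f_convex; lia. Qed.

Lemma sum_curv_range a b m : (a <= b)%N ->
  \sum_(z < m) ((a <= z)%N && (z < b)%N)%:R * curv z =
  (f (minn b m).+1 - f (minn b m)) - (f (minn a m).+1 - f (minn a m)).
Proof.
move=> ab; elim: m => [|m IH]; first by rewrite big_ord0 !minn0 subrr.
rewrite big_ord_recr /= IH.
have [bm|bm] : (b <= m)%N \/ (m < b)%N by lia.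
  have -> : minn b m.+1 = b by lia.
  have -> : minn a m.+1 = a by lia.
  have -> : minn b m = b by lia.
  have -> : minn a m = a by lia.
  by rewrite (leq_gtF bm) andbF mul0r addr0.
have -> : minn b m.+1 = m.+1 by lia.
have -> : minn b m = m by lia.
have [am|am] : (a <= m)%N \/ (m < a)%N by lia.
  have -> : minn a m.+1 = a by lia.
  have -> : minn a m = a by lia.
  by rewrite am bm /curv mul1r; ring.
have -> : minn a m.+1 = m.+1 by lia.
have -> : minn a m = m by lia.
by rewrite leqNgt am mul0r; ring.
Qed.

Lemma window_curv_ge0 x h : 0 <= window_curv x h.
Proof. by apply: sumr_ge0 => z _; rewrite mulr_ge0 // curv_ge0. Qed.

Lemma window_curvS x h : window_curv x h <= window_curv x h.+1.
Proof.
apply: ler_sum => z _; rewrite ler_wpM2r ?curv_ge0 // ler_nat.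
have H : (x <= z + h)%N && (z.+1 < x + h)%N ->
    (x <= z + h.+1)%N && (z.+1 < x + h.+1)%N by lia.
by case: (_ && _) H => // ->.
Qed.

Lemma window_curvE x h : (h < x)%N -> (x + h.+1 < k)%N ->
  window_curv x h.+1 =
  f (x + h.+1)%N - f (x + h)%N - (f (x - h)%N - f (x - h.+1)%N).
Proof.
move=> hx xk.
transitivity (\sum_(z < k - 2) ((x - h.+1 <= z)%N && (z < x + h)%N)%:R * curv z).
  apply: eq_bigr => z _; congr (_%:R * _); congr nat_of_bool.
  by apply/idP/idP; lia.
rewrite sum_curv_range; last lia.
have -> : minn (x + h) (k - 2) = (x + h)%N by lia.
have -> : minn (x - h.+1) (k - 2) = (x - h.+1)%N by lia.
by rewrite -addnS -subSn.
Qed.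

Lemma window_sum0 x : (x < k)%N -> window_sum x 0 = f x.
Proof.
move=> xk; rewrite /window_sum (bigD1 (Ordinal xk)) //= big1 ?addr0.
  by rewrite /in_window addn0 leqnn mul1r.
move=> y yx; rewrite /in_window !addn0 -eqn_leq; case: eqP => [xy|_]; last by rewrite mul0r.
by case/eqP: yx; apply: val_inj.
Qed.

Lemma window_sumS x h : (h < x)%N -> (x + h.+1 < k)%N ->
  window_sum x h.+1 = window_sum x h + (f (x + h.+1)%N + f (x - h.+1)%N).
Proof.
move=> hx xk.
have pick c : (c < k)%N -> \sum_(y < k) (y == c :> nat)%:R * f y = f c.
  move=> ck; rewrite (bigD1 (Ordinal ck)) //= eqxx mul1r big1 ?addr0 // => y yc.
  by case: eqP => [E|_]; [case/eqP: yc; apply: val_inj|rewrite mul0r].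
rewrite /window_sum -(pick (x + h.+1)%N) // -(pick (x - h.+1)%N); last lia.
rewrite -!big_split /=; apply: eq_bigr => y _; rewrite -!mulrDl -!natrD.
congr (_%:R * _); rewrite /in_window.
have [->|] := eqVneq (y : nat) (x + h.+1)%N; first by lia.
have [->|] := eqVneq (y : nat) (x - h.+1)%N; first by lia.
by lia.
Qed.

(** By convexity, the sum of each of the [h] symmetric pairs in the window exceeds
    twice the central value, by at most [h] times the change of slope across the
    window. *)
Lemma window_bias x h : (h <= x)%N -> (x + h < k)%N ->
  0 <= window_sum x h - (2 * h%:R + 1) * f x <= h%:R ^+ 2 * window_curv x h.
Proof.
move=> hx xk.
(* The outermost pair is what one more step of the induction adds. *)
suff [] : 0 <= f (x + h)%N + f (x - h)%N - 2 * f x <= h%:R * window_curv x h /\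
  0 <= window_sum x h - (2 * h%:R + 1) * f x <= h%:R ^+ 2 * window_curv x h by [].
elim: h hx xk => [|h IH] hx xk.
  rewrite addn0 in xk; rewrite addn0 subn0 window_sum0 //.
  by rewrite expr0n /= !mul0r; lra.
have xk' : (x + h < k)%N by lia.
have [/andP[w0 w1] /andP[v0 v1]] := IH (ltnW hx) xk'.
rewrite window_sumS // -natr1.
have D0 := window_curv_ge0 x h; have D1 := window_curvS x h.
have DE := window_curvE hx xk.
have h0 : 0 <= h%:R :> R by [].
have hD := ler_wpM2l h0 D1.
have hhD := ler_wpM2l h0 hD.
split; first by lra.
apply/andP; split; first by lra.
by rewrite expr2 in v1; rewrite expr2; nra.
Qed.

(** Summation by parts, the discrete form of
    [\int x ^ 2 f'' = 2 \int f + boundary terms]; for non-increasing [f] the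
    boundary terms are harmless. *)
Lemma curv_moment m :
  \sum_(z < m) z.+1%:R ^+ 2 * curv z =
  2 * \sum_(z < m) f z.+1 + f 0 + m%:R ^+ 2 * f m.+1 - m.+1%:R ^+ 2 * f m.
Proof.
elim: m => [|m IH]; first by rewrite !big_ord0; ring.
by rewrite !big_ord_recr /= IH /curv -[m.+2%:R]natr1 -[m.+1%:R]natr1; ring.
Qed.

Hypotheses (k2 : (1 < k)%N) (f0 : forall x, 0 <= f x)
  (f_dec : forall x, (x.+1 < k)%N -> f x.+1 <= f x)
  (f1 : \sum_(x < k) f x = 1).

Lemma curv_moment_le : \sum_(z < k - 2) z.+1%:R ^+ 2 * curv z <= 3.
Proof.
have kE : (k = (k - 2).+2)%N by lia.
rewrite curv_moment; set m := (k - 2)%N in kE *.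
have : f m.+1 <= f m by apply: f_dec; lia.
have : m%:R ^+ 2 <= m.+1%:R ^+ 2 :> R by rewrite lerXn2r ?nnegrE // ler_nat.
move: f1 (f0 m) (f0 m.+1); rewrite kE big_ord_recl big_ord_recr /=.
under eq_bigr do rewrite /bump /= add1n.
rewrite /bump /= add1n.
have : 0 <= \sum_(i < m) f i.+1 by apply: sumr_ge0.
have : 0 <= m%:R ^+ 2 :> R by rewrite sqr_ge0.
have := f0 0.
set S := \sum_(i < m) _; move: (m%:R ^+ 2) (m.+1%:R ^+ 2) => A B.
nra.
Qed.

(** Exchanging the sums, the curvature at [z] is seen only from the [O(z / q)]
    windows around [z], whose half-widths are [O(z / q)] too; so it is counted
    with a weight [O(z ^ 2 / q ^ 2)], which [curv_moment_le] controls. *)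
Lemma total_window_bias q (h : nat -> nat) : (1 < q)%N ->
  (forall x, (h x <= x %/ q)%N) -> (forall x, (x < k)%N -> (x + h x < k)%N) ->
  \sum_(x < k) `|window_sum x (h x) / (2 * (h x)%:R + 1) - f x| <=
  12 / q%:R ^+ 2.
Proof.
move=> q1 hq hk.
have q0 : 0 < q%:R :> R by rewrite ltr0n ltnW.
have h_le x : (h x <= x)%N by apply: leq_trans (hq x) (leq_div _ _).
apply: le_trans (_ : \sum_(x < k) 2^-1 * ((h x)%:R * window_curv x (h x)) <= _).
  apply: ler_sum => x _.
  have /andP[] := window_bias (h_le x) (hk x (ltn_ord x)).
  have D0 := window_curv_ge0 x (h x).
  have h0 : 0 <= (h x)%:R :> R by [].
  have hD0 : 0 <= (h x)%:R * window_curv x (h x) by rewrite mulr_ge0.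
  have w0 : 0 < 2 * (h x)%:R + 1 :> R by lra.
  move: (window_sum x (h x)) => w b0 b1.
  rewrite -[f x](mulfK (lt0r_neq0 w0)) -mulrBl ger0_norm; last first.
    by rewrite divr_ge0 ?(ltW w0) // mulrC.
  rewrite ler_pdivrMr // [f x * _]mulrC (le_trans b1) // expr2; nra.
rewrite -mulr_sumr /window_curv.
under eq_bigr do rewrite mulr_sumr.
rewrite exchange_big /=.
(* Since [q >= 2], a centre [x] whose window contains [z] is at most [2 z]. *)
have h_window (z x : nat) : (x <= z + h x)%N && (z.+1 < x + h x)%N ->
    (h x <= (2 * z) %/ q)%N &&
    (z.+1 - (2 * z) %/ q <= x < z.+1 - (2 * z) %/ q + 2 * ((2 * z) %/ q))%N.
  move=> /andP[xz zx].
  have hx2 : (h x <= x %/ 2)%N by apply: leq_trans (hq x) (leq_div2l _ _ q1).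
  have x2z : (x <= 2 * z)%N by lia.
  have hH : (h x <= (2 * z) %/ q)%N by apply: leq_trans (hq x) (leq_div2r _ _).
  by rewrite hH /=; lia.
apply: le_trans (_ : 2^-1 * \sum_(z < k - 2) (8 / q%:R ^+ 2) *
    (z.+1%:R ^+ 2 * curv z) <= _); last first.
  rewrite -mulr_sumr; apply: le_trans (_ : 2^-1 * (8 / q%:R ^+ 2 * 3) <= _).
    apply: ler_wpM2l; first by rewrite invr_ge0.
    by apply: ler_wpM2l; [rewrite divr_ge0 ?exprn_ge0|exact: curv_moment_le].
  by rewrite le_eqVlt; apply/orP; left; apply/eqP; field; rewrite gt_eqF.
rewrite ler_wpM2l ?invr_ge0 //; apply: ler_sum => z _.
under eq_bigr do rewrite mulrA; rewrite -mulr_suml mulrA.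
apply: ler_wpM2r; first exact: curv_ge0.
set H := ((2 * z) %/ q)%N in h_window.
apply: le_trans (_ : 2 * H%:R ^+ 2 <= _); last first.
  have : H%:R <= 2 * z.+1%:R / q%:R :> R.
    rewrite ler_pdivlMr // -!natrM ler_nat (leq_trans (leq_trunc_div _ _)) //.
    by rewrite leq_mul2l leqnSn orbT.
  have -> : 8 / q%:R ^+ 2 * z.+1%:R ^+ 2 = 2 * (2 * z.+1%:R / q%:R) ^+ 2 :> R.
    by field; rewrite gt_eqF.
  by move=> HZ; rewrite ler_wpM2l // lerXn2r ?nnegrE // (le_trans _ HZ).
apply: le_trans (_ : \sum_(x < k) H%:R *
    (z.+1 - H <= x < z.+1 - H + 2 * H)%N%:R <= _).
  apply: ler_sum => x _; case: (boolP (_ && _)) => [/h_window/andP[hH ->]|_].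
    by rewrite !mulr1 ler_nat.
  by rewrite mulr0 mulr_ge0.
rewrite -mulr_sumr -natr_sum expr2 mulrCA ler_wpM2l //.
by rewrite -natrM ler_nat window_count.
Qed.
End convex_sequence.

(** * Risk of window estimates *)

Section window_estimate.
Variables (R : realType) (n k : nat).

Definition extend (p : 'I_k -> R) (x : nat) : R :=
  if insub x is Some i then p i else 0.

Lemma extendE p (i : 'I_k) : extend p i = p i.
Proof. by rewrite /extend valK. Qed.

Lemma extend_lt p x (xk : (x < k)%N) : extend p x = p (Ordinal xk).
Proof. by rewrite -[x]/(val (Ordinal xk)) extendE. Qed.

Definition window_kernel (h : nat -> nat) (x y : 'I_k) : R :=
  (in_window x (h x) y)%:R / (2 * (h x)%:R + 1).

(** The variance at [x] is at most the window average divided by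
    [n (2 h x + 1)].  With [t / (2 h x + 1)] as the scale of its standard
    deviation, the stochastic errors add up to the two terms of the bound that
    involve [t], which remains to be optimized; [B] bounds the bias. *)
Lemma minimax_risk_le_window (h : nat -> nat) (B t : R)
    (F : set ('I_k -> R)) :
  (0 < n)%N -> 0 < t -> (forall p, F p -> is_density p) ->
  (forall p, F p ->
    \sum_(x < k) `|window_sum k (extend p) x (h x) / (2 * (h x)%:R + 1) - p x|
      <= B) ->
  (minimax_risk n F <= (2^-1 * (B + (t * \sum_(x < k) (2 * (h x)%:R + 1)^-1
     + (1 + B) / (n%:R * t)) / 2))%:E)%E.
Proof.
move=> n0 t0 Fd FB.
apply: (@minimax_risk_le_deterministic _ _ _ (linear_estimate (window_kernel h))).
move=> p Fp; have dp := Fd _ Fp; have [p0 p1] := dp.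
have n1 : 0 < n%:R :> R by rewrite ltr0n.
have w0 x : 0 < 2 * (h x)%:R + 1 :> R by rewrite ltr_wpDl ?mulr_ge0.
pose a (x : 'I_k) := \sum_y p y * window_kernel h x y.
have aE x : a x = window_sum k (extend p) x (h x) / (2 * (h x)%:R + 1).
  rewrite /a /window_sum mulr_suml; apply: eq_bigr => y _.
  by rewrite /window_kernel extendE; ring.
have varE (x : 'I_k) : \sum_y p y * window_kernel h x y ^+ 2 = a x / (2 * (h x)%:R + 1).
  rewrite /a mulr_suml; apply: eq_bigr => y _; rewrite /window_kernel.
  by case: (in_window _ _ _); rewrite /= ?mul0r ?expr0n ?mulr0 ?mul0r //; ring.
apply: le_trans (linear_estimate_TV_le (tau := fun x => t / (2 * (h x)%:R + 1))
  _ n0 dp _) _; first by move=> x; rewrite divr_gt0.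
rewrite ler_wpM2l ?invr_ge0 // big_split /=.
have biasB : \sum_x `|a x - p x| <= B.
  by rewrite (eq_bigr _ (fun x _ => congr1 (fun u => `|u - p x|) (aE x))) FB.
apply: lerD => //.
have -> : \sum_(x < k) (t / (2 * (h x)%:R + 1) + n%:R^-1 *
    (\sum_y p y * window_kernel h x y ^+ 2) / (t / (2 * (h x)%:R + 1))) / 2 =
  (t * \sum_(x < k) (2 * (h x)%:R + 1)^-1 + (\sum_x a x) / (n%:R * t)) / 2.
  rewrite -mulr_suml big_split /= mulr_sumr [X in _ = (_ + X) / 2]mulr_suml.
  congr ((_ + _) / 2); apply: eq_bigr => x _; rewrite varE.
  by field; rewrite !gt_eqF.
rewrite ler_wpM2r ?invr_ge0 // lerD2l ler_wpM2r ?invr_ge0 ?mulr_ge0 ?(ltW t0) //.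
have -> : \sum_x a x = 1 + \sum_x (a x - p x).
  by rewrite sumrB p1; ring.
rewrite lerD2l; apply: le_trans biasB; apply: ler_sum => x _; exact: ler_norm.
Qed.
End window_estimate.

Lemma minimax_risk_le_empirical (R : realType) (n k : nat) : (0 < n)%N -> (0 < k)%N ->
  (minimax_risk n (@noninc_convex_densities R k) <=
     (Num.sqrt (k%:R / n%:R))%:E)%E.
Proof.
move=> n0 k0.
have n1 : 0 < n%:R :> R by rewrite ltr0n.
have k1 : 0 < k%:R :> R by rewrite ltr0n.
set r := Num.sqrt _.
have r0 : 0 < r by rewrite sqrtr_gt0 divr_gt0.
have rr : r ^+ 2 = k%:R / n%:R by rewrite sqr_sqrtr // divr_ge0.
apply: le_trans (@minimax_risk_le_window _ n k (fun _ => 0%N) 0 (r / k%:R) _ n0 _ _ _) _.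
- by rewrite divr_gt0.
- by move=> p [].
- move=> p _; rewrite big1 // => x _.
  by rewrite window_sum0 // extendE mulr0 add0r divr1 subrr normr0.
rewrite lee_fin mulr0 !add0r invr1 sumr_const card_ord.
have -> : r / k%:R * k%:R = r by field; rewrite gt_eqF.
have -> : (1 + 0) / (n%:R * (r / k%:R)) = r.
  have -> : (1 + 0) / (n%:R * (r / k%:R)) = (k%:R / n%:R) / r.
    by field; rewrite !gt_eqF.
  by rewrite -rr expr2 mulfK ?gt_eqF.
lra.
Qed.

(** Each term is at most the increment of the right-hand side in [k], because
    [ln u <= u - 1]. *)
Lemma sum_harmonic_le (R : realType) (a : R) k : 0 < a ->
  \sum_(j < k) (1 + j.+1%:R * a)^-1 <= ln (1 + k%:R * a) / a.
Proof.
move=> a0; elim: k => [|k IH]; first by rewrite big_ord0 mul0r addr0 ln1 mul0r.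
rewrite big_ord_recr /=.
have u0 j : 0 < 1 + j%:R * a by rewrite ltr_wpDr // mulr_ge0 // ltW.
have : ln (1 + k%:R * a) - ln (1 + k.+1%:R * a) <= - (a / (1 + k.+1%:R * a)).
  rewrite -ln_div ?posrE //.
  have -> : (1 + k%:R * a) / (1 + k.+1%:R * a) = 1 + - (a / (1 + k.+1%:R * a)).
    by rewrite -natr1; field; rewrite natr1 gt_eqF.
  rewrite le_ln1Dx // ltrN2 ltr_pdivrMr // mul1r -natr1.
  have : 0 <= k%:R * a by rewrite mulr_ge0 // ltW.
  lra.
move: IH; rewrite !ler_pdivlMr // mulrDl [_^-1 * a]mulrC; lra.
Qed.

(** The windows must also shrink near the right end of the range to stay
    symmetric; the inverse widths there add only a logarithm. *)
Lemma sum_window_width_le (R : realType) q k : (0 < q)%N ->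
  \sum_(x < k) (2 * (minn (x %/ q) (k.-1 - x))%:R + 1)^-1 <=
  2 * (q%:R * ln (1 + k%:R / q%:R) + ln (1 + k%:R)) :> R.
Proof.
move=> q0; have q1 : 0 < q%:R :> R by rewrite ltr0n.
have pos j : 0 < 2 * j%:R + 1 :> R by rewrite ltr_wpDl ?mulr_ge0.
apply: le_trans (_ : \sum_(x < k) (2 * (1 + x.+1%:R / q%:R)^-1 +
    2 * (1 + (rev_ord x).+1%:R * 1)^-1) <= _).
  apply: ler_sum => x _.
  have pos' j (b : R) : 0 <= b -> 0 < 1 + j%:R * b by move=> b0; rewrite ltr_wpDr ?mulr_ge0.
  apply: le_trans (_ : (2 * (x %/ q)%:R + 1)^-1 + (2 * (k.-1 - x)%:R + 1)^-1 <= _).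
    by case: leqP => _; rewrite ?lerDl ?lerDr invr_ge0 ltW.
  have half (u v : R) : 0 < u -> 0 < v -> v <= 2 * u -> u^-1 <= 2 * v^-1.
    by move=> u0 v0 vu; rewrite ler_pdivlMr // mulrC ler_pdivrMr.
  apply: lerD; apply: half => //; rewrite ?pos' ?invr_ge0 ?(ltW q1) //.
    have : x.+1%:R / q%:R <= (x %/ q)%:R + 1 :> R.
      by rewrite ler_pdivrMr // natr1 -natrM ler_nat ltn_ceil.
    have : 0 <= (x %/ q)%:R :> R by [].
    lra.
  have -> : (k.-1 - x = rev_ord x)%N by rewrite /=; lia.
  have : 0 <= (rev_ord x)%:R :> R by [].
  rewrite -natr1; lra.
rewrite big_split /= -!mulr_sumr -mulrDr ler_wpM2l // lerD //.
  have := @sum_harmonic_le R q%:R^-1 k; rewrite invr_gt0 => /(_ q1).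
  by rewrite invrK mulrC.
rewrite (reindex_inj rev_ord_inj) /=.
rewrite (eq_bigr (fun j : 'I_k => (1 + j.+1%:R * 1)^-1)).
  by have := @sum_harmonic_le R 1 k ltr01; rewrite divr1 mulr1.
move=> j _; congr ((1 + _%:R * 1)^-1); have := ltn_ord j; lia.
Qed.

(** * Upper bound at logarithmic scale *)

Section fifth_roots.
Variable R : realType.
Implicit Types x y L : R.

Lemma fifth_rootK x : 0 <= x -> (x `^ 5^-1) ^+ 5 = x.
Proof.
by move=> x0; rewrite -powR_mulrn ?powR_ge0 // -powRrM mulVf // powRr1.
Qed.

Lemma powR_two_fifths x : x `^ (2 / 5) = (x `^ 5^-1) ^+ 2.
Proof. by rewrite -powR_mulrn ?powR_ge0 // -powRrM mulrC. Qed.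

Lemma ler_pX5 x y : 0 <= x -> 0 <= y -> (x ^+ 5 <= y ^+ 5) = (x <= y).
Proof. by move=> x0 y0; rewrite ler_pXn2r. Qed.

Lemma ln_le_sub1 x : 0 < x -> ln x <= x - 1.
Proof.
move=> x0; rewrite -[x in ln x](subrK 1) addrC le_ln1Dx //; lra.
Qed.
End fifth_roots.

Lemma minimax_risk_le1 (R : realType) (n k : nat) :
  (minimax_risk n (@noninc_convex_densities R k) <= 1%:E)%E.
Proof.
apply: (@minimax_risk_le_deterministic _ _ _ (fun _ _ => 0)) => p [dp _ _].
have [p0 p1] := dp; rewrite -mulr_suml sum_iid_pmf // mul1r /TV.
under eq_bigr do rewrite sub0r normrN ger0_norm //.
by rewrite p1; lra.
Qed.

(** With window half-widths [x / q] and [q] of order [1 / e], the bias is of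
    order [e ^ 2] and the stochastic error of order [sqrt (L / (e n))], because
    the inverse widths sum to [O(L / e)]; [e] is chosen to make these equal. *)
Lemma minimax_risk_le_log_scale (R : realType) (n k : nat) (m e L : R) :
  (0 < n)%N -> (1 < k)%N -> 0 < m -> m <= k%:R -> 0 < e -> m ^+ 5 = n%:R ->
  e ^+ 5 = L / n%:R -> 1 <= L -> L <= n%:R -> ln (k%:R / m) = L * ln 3 ->
  (minimax_risk n (@noninc_convex_densities R k) <= (16 * e ^+ 2)%:E)%E.
Proof.
move=> n0 k2 m0 mk e0 m5 e5 L1 Ln lnk.
have n1 : 0 < n%:R :> R by rewrite ltr0n.
have k1 : 1 <= k%:R :> R by rewrite ler1n ltnW.
have e1 : e <= 1.
  by rewrite -(ler_pX5 (ltW e0) ler01) e5 expr1n ler_pdivrMr // mul1r.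
have me5 : (m * e) ^+ 5 = L by rewrite exprMn m5 e5; field; rewrite gt_eqF.
have me1 : 1 <= m * e.
  by rewrite -ler_pX5 // ?mulr_ge0 ?(ltW m0) ?(ltW e0) // expr1n me5.
have meL : m * e <= L.
  by rewrite -[L in leRHS]me5 -[leLHS]expr1 ler_weXn2l.
have km0 : 0 < k%:R / m by rewrite divr_gt0 // (lt_le_trans _ k1).
have ln3 : ln 3 <= 2 :> R by have := @ln_le_sub1 R 3 ltac:(lra); lra.
have ln2 : ln 2 <= 1 :> R by have := @ln_le_sub1 R 2 ltac:(lra); lra.
have lnMp (x y : R) : 0 < x -> 0 < y -> ln (x * y) = ln x + ln y.
  by move=> x0 y0; rewrite lnM.
have lnk2 : ln (k%:R / m) <= 2 * L by rewrite lnk; nra.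
pose q := (Num.trunc e^-1).+1.
have ei1 : 1 <= e^-1 by rewrite -invr1 lef_pV2 ?posrE.
have q1 : (1 < q)%N by rewrite ltnS truncn_gt0.
have qe : e^-1 <= q%:R by rewrite ltW // -truncn_lt_nat // (le_trans ler01).
have qe2 : q%:R <= 2 / e.
  rewrite /q -natr1; have : (Num.trunc e^-1)%:R <= e^-1.
    by rewrite truncn_le (le_trans ler01).
  lra.
have q0 : 0 < q%:R :> R by rewrite ltr0n.
pose h x := minn (x %/ q) (k.-1 - x).
pose B := 12 / q%:R ^+ 2 : R.
pose S : R := \sum_(x < k) (2 * (h x)%:R + 1)^-1.
have SL : S <= 24 * L / e.
  apply: le_trans (sum_window_width_le R k (ltnW q1)) _.
  have ln_a : ln (1 + k%:R / q%:R) <= 4 * L.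
    apply: le_trans (_ : ln (2 * (k%:R / m * (m * e))) <= _).
      rewrite ler_ln ?posrE; last 2 first.
      - by rewrite addr_gt0 // divr_gt0 // (lt_le_trans _ k1).
      - by rewrite mulr_gt0 // mulr_gt0 // mulr_gt0.
      have -> : k%:R / m * (m * e) = k%:R * e by field; rewrite gt_eqF.
      have : k%:R / q%:R <= k%:R * e.
        rewrite ler_wpM2l // ?(le_trans ler01 k1) //.
        by rewrite -[e]invrK lef_pV2 ?posrE // invr_gt0.
      have : 1 <= k%:R * e.
        apply: le_trans me1 _; rewrite ler_wpM2r // ltW //.
      lra.
    have me0 : 0 < m * e by rewrite mulr_gt0.
    rewrite (lnMp 2) ?(mulr_gt0 km0) // (lnMp (k%:R / m)) //.
    by have := ln_le_sub1 me0; lra.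
  have ln_b : ln (1 + k%:R) <= 4 * (L / e).
    apply: le_trans (_ : ln (2 * (k%:R / m * m)) <= _).
      rewrite divfK ?gt_eqF // ler_ln ?posrE; lra.
    rewrite (lnMp 2) ?(mulr_gt0 km0) // (lnMp (k%:R / m)) //.
    have := ln_le_sub1 m0.
    have : m <= L / e by rewrite ler_pdivlMr.
    have : L <= L / e by rewrite ler_pdivlMr // -[leRHS]mulr1 ler_wpM2l //; lra.
    lra.
  have : q%:R * ln (1 + k%:R / q%:R) <= 2 / e * (4 * L).
    apply: ler_pM => //.
    by rewrite ln_ge0 // lerDl divr_ge0 ?(ltW q0).
  have -> : 2 / e * (4 * L) = 8 * (L / e) by field; rewrite gt_eqF.
  rewrite -[24 * L / e]mulrA; lra.
have Be : B <= 12 * e ^+ 2.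
  rewrite /B ler_wpM2l // -[e]invrK exprVn lef_pV2 ?posrE ?exprn_gt0 ?invr_gt0 //.
  by rewrite lerXn2r ?nnegrE ?invr_ge0 // ltW.
have e2 : e ^+ 2 <= 1 by rewrite exprn_ile1 // ltW.
have t0 : 0 < (n%:R * e ^+ 2)^-1 by rewrite invr_gt0 mulr_gt0 ?exprn_gt0.
apply: le_trans (@minimax_risk_le_window _ n k h B _ _ n0 t0 _ _) _.
- by move=> p [].
- move=> p [[p0 p1] pdec pconv].
  under eq_bigr => x _ do rewrite -(extendE p x).
  apply: total_window_bias => //.
  - move=> x xk; have xk1 := ltnW xk; have xk0 := ltnW xk1.
    by rewrite !extend_lt; apply: pconv.
  - by move=> x; rewrite /extend; case: insubP.
  - by move=> x xk; rewrite (extend_lt _ xk) (extend_lt _ (ltnW xk)); apply: pdec.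
  - by rewrite -[RHS]p1; apply: eq_bigr => x _; rewrite extendE.
  - by move=> x; rewrite geq_minl.
  - move=> x xk; rewrite /h; have := geq_minr (x %/ q) (k.-1 - x).
    by move: (minn _ _) => w; clear -xk; lia.
rewrite lee_fin -/S.
have -> : n%:R * (n%:R * e ^+ 2)^-1 = (e ^+ 2)^-1 by field; rewrite !gt_eqF.
rewrite invrK.
have : (n%:R * e ^+ 2)^-1 * S <= 24 * e ^+ 2.
  apply: le_trans (ler_wpM2l (ltW t0) SL) _.
  have -> : (n%:R * e ^+ 2)^-1 * (24 * L / e) = 24 * (L / n%:R) / e ^+ 3.
    by field; rewrite !gt_eqF.
  rewrite -e5 le_eqVlt; apply/orP; left; apply/eqP; field; by rewrite gt_eqF.
have : (1 + B) * e ^+ 2 <= 13 * e ^+ 2.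
  by rewrite ler_wpM2r ?sqr_ge0 //; lra.
have e20 := sqr_ge0 e; by move: (_ * S) ((1 + B) * _) => X Y; lra.
Qed.

(** * Assembling the rates *)

(** The tilt [a = 32 ^ -3] satisfies [a ^ 2 n <= N T ^ 5] as soon as
    [T >= (n / N) ^ (1/5) / 32]; the first factor 16 comes from [T e <= 4], and
    the other two from [minimax_risk_ge_multiscale]. *)
Definition lower_const (R : realType) : R := (32^-1) ^+ 3 / 16 / 1024 / 16.

Lemma lower_const_gt0 (R : realType) : 0 < lower_const R.
Proof.
have : 0 < (32^-1) ^+ 3 :> R by rewrite exprn_gt0 // invr_gt0.
rewrite /lower_const; lra.
Qed.

(** About [L] dyadic scales fit into the range, since [k = m 3 ^ L] leaves room
    for [2 ^ N] with [N <= L], and about [(n / N) ^ (1/5)] blocks per scale are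
    the fewest that a constant tilt allows. *)
Lemma minimax_risk_ge_log_scale (R : realType) (n k : nat) (m e L : R) :
  (0 < n)%N -> (0 < k)%N -> 16 <= m -> 0 < e -> m ^+ 5 = n%:R ->
  e ^+ 5 = L / n%:R -> 1 <= L -> L <= n%:R -> ln (k%:R / m) = L * ln 3 ->
  ((lower_const R * e ^+ 2)%:E <= minimax_risk n (@noninc_convex_densities R k))%E.
Proof.
move=> n0 k0 m16 e0 m5 e5 L1 Ln lnk.
have m0 : 0 < m by lra.
have n1 : 0 < n%:R :> R by rewrite ltr0n.
have k1 : 0 < k%:R :> R by rewrite ltr0n.
have L0 : 0 <= L by lra.
pose N := Num.trunc L.
have N1 : (0 < N)%N by rewrite truncn_gt0.
have N0 : 1 <= N%:R :> R by rewrite ler1n.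
have NL : N%:R <= L by rewrite truncn_le.
have LN : L <= 2 * N%:R.
  have : L < N.+1%:R by rewrite -truncn_lt_nat.
  rewrite -natr1; lra.
have Nn : n%:R / N%:R >= 0 :> R by rewrite divr_ge0.
pose y : R := (n%:R / N%:R) `^ 5^-1.
have y5 : y ^+ 5 = n%:R / N%:R by exact: fifth_rootK.
have y0 : 0 <= y by exact: powR_ge0.
have N0' : 0 < N%:R :> R by lra.
have y1 : 1 <= y.
  by rewrite -ler_pX5 // y5 expr1n ler_pdivlMr // mul1r (le_trans NL).
have ym : y <= m.
  by rewrite -ler_pX5 ?(ltW m0) // y5 m5 ler_pdivrMr // ler_peMr // ltW.
have ye : y * e <= 2.
  rewrite -ler_pX5 ?mulr_ge0 ?(ltW e0) // exprMn y5 e5.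
  have -> : n%:R / N%:R * (L / n%:R) = L / N%:R by field; rewrite !gt_eqF.
  apply: (@le_trans _ _ 2); first by rewrite ler_pdivrMr.
  by rewrite -[leLHS]expr1 ler_weXn2l // ler1n.
pose T := (Num.trunc (y / 32)).+1.
have yT : y / 32 <= T%:R by rewrite ltW // -truncn_lt_nat // divr_ge0.
have Ty : T%:R <= y / 32 + 1.
  by rewrite /T -natr1 lerD2r truncn_le divr_ge0.
have ln3 : 0 <= ln 3 :> R by rewrite ln_ge0 // ler1n.
have N3 : 3 ^+ N * m <= k%:R.
  rewrite -ler_pdivlMr // -ler_ln ?posrE ?exprn_gt0 ?divr_gt0 //.
  by rewrite lnXn // lnk -[leLHS]mulr_natl ler_wpM2r.
have a0 : 0 < 32^-1 :> R by rewrite invr_gt0.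
have a1 : 32^-1 <= 1 :> R by lra.
(* Here [8 T <= y / 4 + 8 <= m], which uses [16 <= m]. *)
have NTk : (2 ^ N * (8 * T) <= k)%N.
  rewrite -(ler_nat R) !natrM natrX (le_trans _ N3) //.
  apply: ler_pM => //; last by lra.
  by rewrite lerXn2r ?nnegrE // ler_nat.
have := @minimax_risk_ge_multiscale R n k N T (32^-1 ^+ 3) n0 N1 isT NTk.
move=> H; apply: le_trans (H _ _) => {H}.
- rewrite lee_fin /lower_const.
  have T0 : 0 < T%:R :> R by rewrite ltr0n.
  set a := 32^-1 ^+ 3; have a00 : 0 <= a by rewrite exprn_ge0 // ltW.
  have -> : a / 16 / 1024 / 16 * e ^+ 2 = a * (e / 4) ^+ 2 / 1024 / 16 by field.
  do 2!(apply: ler_wpM2r; first by rewrite invr_ge0 ler0n).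
  apply: ler_wpM2l => //.
  rewrite -exprVn lerXn2r ?nnegrE ?divr_ge0 ?invr_ge0 ?(ltW e0) //.
  rewrite ler_pdivrMr // mulrC -ler_pdivrMr ?invr_gt0 // invrK.
  have : T%:R * e <= 2 * (y * e) by rewrite mulrA ler_wpM2r ?(ltW e0) //; lra.
  by rewrite mulrC; lra.
- by rewrite exprn_ge0 ?(ltW a0) //= exprn_ile1 ?(ltW a0).
- apply: le_trans (_ : N%:R * (y / 32) ^+ 5 <= _); last first.
    by rewrite ler_wpM2l // lerXn2r ?nnegrE ?divr_ge0.
  have -> : N%:R * (y / 32) ^+ 5 = 32^-1 ^+ 5 * n%:R.
    by rewrite exprMn y5; move: (32^-1 ^+ 5) => b; field; rewrite gt_eqF.
  rewrite ler_wpM2r // -exprM; apply: ler_wiXn2l => //; exact: ltW.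
Qed.

(** A single scale, whose tilt is limited by the sample size instead of by
    convexity; it needs [k >= 16], below which the rate is the parametric one. *)
Lemma minimax_risk_ge_small_range (R : realType) (n k : nat) (m : R) :
  (0 < n)%N -> (1 < k)%N -> 0 < m -> m ^+ 5 = n%:R -> k%:R < 3 * m ->
  ((Num.sqrt (k%:R / n%:R) / 6 / 1024 / 16)%:E <=
     minimax_risk n (@noninc_convex_densities R k))%E.
Proof.
move=> n0 k2 m0 m5 km.
have n1 : 0 < n%:R :> R by rewrite ltr0n.
have nV0 : 0 <= n%:R^-1 :> R by rewrite invr_ge0.
have [k16|k16] := ltnP k 16.
  apply: le_trans (minimax_risk_ge_two_points R n0 k2); rewrite lee_fin.
  have r0 : 0 < Num.sqrt n%:R :> R by rewrite sqrtr_gt0.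
  have : Num.sqrt (k%:R / n%:R) <= 4 * (Num.sqrt n%:R)^-1 :> R.
    have -> : 4 = Num.sqrt (4 ^+ 2) :> R by rewrite sqrtr_sqr ger0_norm.
    rewrite -sqrtrV -?sqrtrM ?sqr_ge0 // ler_wsqrtr // ler_wpM2r //.
    by rewrite -natrX ler_nat ltnW.
  have -> : (48 * Num.sqrt n%:R)^-1 = 48^-1 * (Num.sqrt n%:R)^-1 :> R by rewrite invfM.
  have : 0 < (Num.sqrt n%:R)^-1 :> R by rewrite invr_gt0.
  lra.
pose T := (k %/ 16)%N.
have T0 : (0 < T)%N by rewrite divn_gt0.
have T1 : 0 < T%:R :> R by rewrite ltr0n.
pose a : R := T%:R ^+ 2 * Num.sqrt (T%:R / n%:R).
have a2 : a ^+ 2 * n%:R = T%:R ^+ 5.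
  rewrite exprMn sqr_sqrtr ?divr_ge0 //; field; by rewrite gt_eqF.
have Tm : T%:R <= m.
  have : 16 * T%:R <= k%:R :> R by rewrite -natrM ler_nat mulnC leq_trunc_div.
  lra.
have a0 : 0 <= a by rewrite mulr_ge0 ?sqrtr_ge0 ?exprn_ge0.
have a1 : a <= 1.
  rewrite -(@ler_pXn2r _ 2) ?nnegrE // expr1n.
  have -> : a ^+ 2 = T%:R ^+ 5 / n%:R by rewrite -a2 mulfK ?gt_eqF.
  by rewrite ler_pdivrMr // mul1r -m5 ler_pX5 // ltW.
have Tk : (2 ^ 1 * (8 * T) <= k)%N.
  by rewrite mulnA mulnC leq_trunc_div.
apply: le_trans (minimax_risk_ge_multiscale (a := a) n0 (isT : 0 < 1)%N T0 Tk _ _); last 2 first.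
- by rewrite a0 a1.
- by rewrite a2 mul1r.
rewrite lee_fin.
do 2!(apply: ler_wpM2r; first by rewrite invr_ge0 ler0n).
rewrite /a mulrAC divff ?expf_neq0 ?gt_eqF // mul1r.
rewrite ler_pdivrMr //.
have -> : 6 = Num.sqrt (6 ^+ 2) :> R by rewrite sqrtr_sqr ger0_norm.
rewrite -sqrtrM; last by rewrite divr_ge0.
rewrite ler_wsqrtr // mulrAC ler_wpM2r //.
rewrite -natrX -natrM ler_nat /T; lia.
Qed.

Theorem theorem2p2 (R : realType) :
  exists C : R, 1 <= C /\
  exists n0 : nat, forall n k : nat, (n0 <= n)%N -> (1 <= n)%N -> (2 <= k)%N ->
    ((C^-1)%:E <=
       minimax_risk n (@noninc_convex_densities R k) * ((rate R n k)^-1)%:E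
     <= C%:E)%E.
Proof.
pose c : R := lower_const R; have c0 : 0 < c := lower_const_gt0 R.
have c1 : c <= 1 / 6 / 1024 / 16.
  have : (32^-1) ^+ 3 <= 1 :> R by rewrite exprn_ile1 ?invr_ge0 //; lra.
  rewrite /c /lower_const; lra.
exists (c^-1 + 16); split.
  have : 0 < c^-1 by rewrite invr_gt0.
  lra.
exists (Num.trunc ((16 : R) ^+ 5)).+1 => n k n_large n1 k2.
have n0 : 0 < n%:R :> R by rewrite ltr0n.
have k0 : 0 < k%:R :> R by rewrite ltr0n ltnW.
suff [r0 lower upper] : [/\ 0 < rate R n k,
    ((c * rate R n k)%:E <= minimax_risk n (@noninc_convex_densities R k))%E &
    (minimax_risk n (@noninc_convex_densities R k) <= (16 * rate R n k)%:E)%E].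
  have rV0 : (0 <= ((rate R n k)^-1)%:E)%E by rewrite lee_fin invr_ge0 ltW.
  have cV0 : 0 < c^-1 by rewrite invr_gt0.
  apply/andP; split.
    apply: le_trans (lee_wpmul2r rV0 lower).
    rewrite -EFinM mulfK ?gt_eqF // lee_fin -[c in leRHS]invrK lef_pV2 ?posrE //; lra.
  apply: le_trans (lee_wpmul2r rV0 upper) _.
  rewrite -EFinM mulfK ?gt_eqF // lee_fin; lra.
pose m : R := n%:R `^ 5^-1.
have m5 : m ^+ 5 = n%:R by exact: fifth_rootK.
have m16 : 16 <= m.
  by rewrite -ler_pX5 ?powR_ge0 // m5 ltW // -truncn_lt_nat // exprn_ge0.
have m0 : 0 < m by lra.
have := erefl (rate R n k); rewrite [in RHS]/rate -/m.
case: ltP => [km ->|km].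
  have r0 : 0 < Num.sqrt (k%:R / n%:R) :> R by rewrite sqrtr_gt0 divr_gt0.
  split=> //.
    apply: le_trans (minimax_risk_ge_small_range n1 k2 m0 m5 km).
    rewrite lee_fin; have := ler_wpM2r (ltW r0) c1; lra.
  apply: le_trans (minimax_risk_le_empirical R n1 (ltnW k2)) _.
  rewrite lee_fin; lra.
have ln3 : 0 < ln 3 :> R by rewrite ln_gt0 // ltr1n.
have km0 : 0 < k%:R / m by rewrite divr_gt0.
case: ltP => [kn ->|kn ->].
  pose L := log3 (k%:R / m).
  have lnk : ln (k%:R / m) = L * ln 3 by rewrite /L /log3 divfK // gt_eqF.
  have L1 : 1 <= L.
    by rewrite ler_pdivlMr // mul1r ler_ln ?posrE // ler_pdivlMr.
  have Ln : L <= n%:R.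
    rewrite ler_pdivrMr // [leRHS]mulr_natl -lnXn // ler_ln ?posrE ?exprn_gt0 //.
    by rewrite ler_pdivrMr // mulrC ltW.
  rewrite -/L powR_two_fifths; set e := _ `^ 5^-1.
  have e0 : 0 < e by rewrite powR_gt0 // divr_gt0 // (lt_le_trans _ L1).
  have e5 : e ^+ 5 = L / n%:R.
    by rewrite fifth_rootK // divr_ge0 // (le_trans _ L1).
  split; first by rewrite exprn_gt0.
    exact: (minimax_risk_ge_log_scale n1 (ltnW k2) m16 e0 m5 e5 L1 Ln lnk).
  have mk : m <= k%:R by lra.
  exact: (minimax_risk_le_log_scale n1 k2 m0 mk e0 m5 e5 L1 Ln lnk).
split=> //; rewrite !mulr1; last first.
  by apply: le_trans (minimax_risk_le1 R n k) _; rewrite lee_fin; lra.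
(* With [n] scales, one block on each and a full tilt, the risk is bounded below
   by a constant. *)
have kn' : (2 ^ n * (8 * 1) <= k)%N.
  rewrite -(ler_nat R) natrM natrX (le_trans _ kn) // mulrC muln1.
  by apply: ler_pM => //; [lra|rewrite lerXn2r ?nnegrE // ler_nat].
have H := @minimax_risk_ge_multiscale R n k n 1 1 n1 n1 isT kn'.
apply: le_trans (H _ _).
- by rewrite lee_fin expr1n; lra.
- by rewrite ler01 lexx.
- by rewrite !expr1n mul1r mulr1.
Qed.
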